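(* Let $A$ be a unital $C^*$-algebra and let $I\subset \mathrm{Re}(A)$. Then $(I,A)$ is an ultraweak $I^*$-algebra if and only if $(I,A)$ is a weak $I^*$-algebra; that is, $I$ is an ultraweak isocone of $A$ if and only if $I$ is a weak isocone of $A$.
   Context: $A$ is a unital $C^*$-algebra with unit $1$, and $\mathrm{Re}(A)$ is the set of its self-adjoint elements. For $a,b\in\mathrm{Re}(A)$ put $a\vee b=\frac12(a+b+|a-b|)$ and $a\wedge b=\frac12(a+b-|a-b|)$, where $|\cdot|$ is defined by continuous functional calculus. $I(\mathbb{R})$ denotes the set of continuous non-decreasing functions $\mathbb{R}\to\mathbb{R}$; for $\phi\in I(\mathbb{R})$ and $a\in \mathrm{Re}(A)$, $\phi(a)$ is defined by continuous functional calculus, and $\phi(I)=\{\phi(a): a\in I\}$. A subset $I\subset\mathrm{Re}(A)$ is a weak isocone of $A$ if: (1) $x\cdot 1\in I$ for all $x\in\mathbb{R}$; (2) $b+b'\in I$ for all $b,b'\in I$; (3) $\lambda b\in I$ for all real $\lambda\ge 0$ and $b\in I$; (4) for all $b,b'\in I$ with $bb'=b'b$, $b\vee b'\in I$ and $b\wedge b'\in I$; (5) $I$ is norm-closed; (6) $\overline{I-I}=\mathrm{Re}(A)$, where $I-I=\{b-b' : b,b'\in I\}$ and the bar denotes norm closure. A subset $I\subset\mathrm{Re}(A)$ is an ultraweak isocone of $A$ if: (1) $x\cdot 1\in I$ for all $x\in\mathbb{R}$; (2) $b+b'\in I$ for all $b,b'\in I$; (3) $\phi(I)\subset I$ for all $\phi\in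 I(\mathbb{R})$; (4) $I$ is norm-closed; (5) $\overline{I-I}=\mathrm{Re}(A)$. $(I,A)$ is called a weak (resp. ultraweak) $I^*$-algebra when $I$ is a weak (resp. ultraweak) isocone of $A$. *)

(* Defs.v *)
(* MathComp-Analysis, over an arbitrary [R : realType]; complex scalars are
   [R[i]] from mathcomp-real-closed. *)
From HB Require Import structures.
From mathcomp Require Import all_boot all_order all_algebra.
From mathcomp Require Import all_classical all_reals all_analysis.
From mathcomp Require Import complex.

Set Implicit Arguments.
Unset Strict Implicit.
Unset Printing Implicit Defensive.

Import Order.TTheory GRing.Theory Num.Theory.
Import numFieldNormedType.Exports.

Local Open Scope classical_set_scope.
Local Open Scope ring_scope.
Local Open Scope complex_scope.

(* The library has no join of rings with normed modules, and one can no longer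
   be declared downstream of [numDomainType], which inherits from both.  The
   product is therefore part of the mixin, over a Banach space, and every
   C*-algebra is equipped with the resulting [algType] structure below; as for
   every [algType], the unit is nonzero.
   The norm of a normed module over [R[i]] takes its values in [R[i]], where
   [0 <= x] forces [x] to be real. *)
HB.mixin Record isCStarAlgebra (R : realType) A
    of CompleteNormedModule R[i] A := {
  cstar_one : A;
  cstar_mul : A -> A -> A;
  star : A -> A;
  cstar_mulA : associative cstar_mul;
  cstar_mul1 : left_id cstar_one cstar_mul;
  cstar_mulr1 : right_id cstar_one cstar_mul;
  cstar_mulDl : left_distributive cstar_mul +%R;
  cstar_mulDr : right_distributive cstar_mul +%R;
  cstar_one_neq0 : cstar_one != 0;
  cstar_scaleAl : forall (c : R[i]) x y,
    c *: cstar_mul x y = cstar_mul (c *: x) y;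
  cstar_scaleAr : forall (c : R[i]) x y,
    c *: cstar_mul x y = cstar_mul x (c *: y);
  starK : involutive star;
  starD : {morph star : x y / x + y};
  starZ : forall (c : R[i]) x, star (c *: x) = c^* *: star x;
  cstar_starM : forall x y,
    star (cstar_mul x y) = cstar_mul (star y) (star x);
  cstar_normM : forall x y, `|cstar_mul x y| <= `|x| * `|y|;
  cstar_identity_mul : forall x, `|cstar_mul (star x) x| = `|x| ^+ 2
}.

#[short(type="cstarAlgType")]
HB.structure Definition CStarAlgebra (R : realType) :=
  {A of isCStarAlgebra R A & CompleteNormedModule R[i] A}.

Section CStarAlgebraRing.
Context (R : realType) (A : cstarAlgType R).

HB.instance Definition _ := GRing.Zmodule_isNzRing.Build A
  (@cstar_mulA R A) (@cstar_mul1 R A) (@cstar_mulr1 R A) (@cstar_mulDl R A)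
  (@cstar_mulDr R A) (@cstar_one_neq0 R A).
HB.instance Definition _ := GRing.Lmodule_isLalgebra.Build R[i] A
  (@cstar_scaleAl R A).
HB.instance Definition _ := GRing.Lalgebra_isAlgebra.Build R[i] A
  (@cstar_scaleAr R A).

Lemma starM (x y : A) : star (x * y) = star y * star x.
Proof. exact: cstar_starM. Qed.

Lemma cstar_normM_le (x y : A) : `|x * y| <= `|x| * `|y|.
Proof. exact: cstar_normM. Qed.

Lemma cstar_identity (x : A) : `|star x * x| = `|x| ^+ 2.
Proof. exact: cstar_identity_mul. Qed.

End CStarAlgebraRing.

Section CStar.
Context {R : realType} {A : cstarAlgType R}.
Implicit Types (a b : A) (I : set A).

Definition selfadjoint : set A := [set a | star a = a].

Definition spectrum a : set R[i] :=
  [set z | ~ exists b, (z *: 1 - a) * b = 1 /\ b * (z *: 1 - a) = 1].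

(* The ascription to [R[i]^o] selects the norm topology on the scalars. *)
Definition continuous_on_spectrum a (f : R[i] -> R[i]) : Prop :=
  {within (spectrum a : set R[i]^o), continuous (f : R[i]^o -> R[i]^o)}.

(* [Phi] is the continuous unital *-homomorphism from C(spectrum a) to [A]
   sending the inclusion of the spectrum to [a].  An element of C(spectrum a)
   is represented by any total function that is continuous on the spectrum;
   [fcalc_ext] says that the representative does not matter, and nothing else
   is said about functions that are not continuous on the spectrum.  Linearity
   follows from [fcalcM] and [fcalc_cst]. *)
Record functional_calculus a (Phi : (R[i] -> R[i]) -> A) : Prop := {
  fcalc_ext : forall f g, continuous_on_spectrum a f ->
    (forall z, spectrum a z -> f z = g z) -> Phi f = Phi g;
  fcalcD : forall f g, continuous_on_spectrum a f ->
    continuous_on_spectrum a g -> Phi (fun z => f z + g z) = Phi f + Phi g;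
  fcalcM : forall f g, continuous_on_spectrum a f ->
    continuous_on_spectrum a g -> Phi (fun z => f z * g z) = Phi f * Phi g;
  fcalc_star : forall f, continuous_on_spectrum a f ->
    Phi (fun z => (f z)^*) = star (Phi f);
  fcalc_cst : forall c : R[i], Phi (fun=> c) = c *: 1;
  fcalc_id : Phi id = a;
  fcalc_norm_le : forall f (M : R[i]), continuous_on_spectrum a f ->
    (forall z, spectrum a z -> `|f z| <= M) -> `|Phi f| <= M
}.

(* For self-adjoint [a] such a [Phi] exists and is unique on C(spectrum a);
   the default value [fun=> 0] is only used when there is none. *)
Definition cfc a : (R[i] -> R[i]) -> A :=
  xget ((fun=> 0) : (R[i] -> R[i]) -> A) (functional_calculus a).

(* The spectrum of a self-adjoint element is real, so a real function is
   applied through the real part. *)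
Definition cfcR (phi : R -> R) a : A := cfc a (fun z => (phi (complex.Re z))%:C).

Definition cabs a : A := cfcR (fun x : R => `|x|) a.

Definition cjoin a b : A := (2^-1 : R[i]) *: (a + b + cabs (a - b)).

Definition cmeet a b : A := (2^-1 : R[i]) *: (a + b - cabs (a - b)).

Definition isotone_continuous : set (R -> R) :=
  [set phi | continuous phi /\ {homo phi : x y / x <= y}].

Record weak_isocone I : Prop := {
  weak_sub : I `<=` selfadjoint;
  weak_cst : forall x : R, I (x%:C *: 1);
  weak_add : forall b b', I b -> I b' -> I (b + b');
  weak_scale : forall (l : R) b, 0 <= l -> I b -> I (l%:C *: b);
  weak_lattice : forall b b', I b -> I b' -> b * b' = b' * b ->
    I (cjoin b b') /\ I (cmeet b b');
  weak_closed : closed I;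
  weak_dense : closure [set b - b' | b in I & b' in I] = selfadjoint
}.

Record ultraweak_isocone I : Prop := {
  ultraweak_sub : I `<=` selfadjoint;
  ultraweak_cst : forall x : R, I (x%:C *: 1);
  ultraweak_add : forall b b', I b -> I b' -> I (b + b');
  ultraweak_isotone : forall phi, isotone_continuous phi ->
    [set cfcR phi b | b in I] `<=` I;
  ultraweak_closed : closed I;
  ultraweak_dense : closure [set b - b' | b in I & b' in I] = selfadjoint
}.

End CStar.

(* Main.v *)
(* Weak to ultraweak: uniformly on the spectrum of [b], an isotone continuous
   [phi] is nearly a finite maximum of functions [phi t + L * min (x - t) 0], so
   [phi b] is a limit of elements obtained from [b] by the cone and lattice
   operations.

   Ultraweak to weak: let [b, b' >= 1] commute, with join [c] and meet [d].  As
   [c + d = b + b'] and [c d = b b'], the element [X = b^n + b'^n = c^n + d^n]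
   satisfies [c^n <= X <= 2 c^n] for [n = 2^k], hence [c <= X^(1/n) <= 2^(1/n) c]
   and [X^(1/n)] tends to [c]; it is obtained from [b] and [b'] by isotone
   functions and a sum.  Constants remove the bound by 1, and meets are joins for
   [- I], which inherits the axioms used.

   The functional calculus has to be constructed, which rests on [|a|] or [- |a|]
   being in the spectrum of a self-adjoint [a].  This is proved without complex
   analysis, by iterating [u |-> u^2] on [u = a^2] and controlling
   [u (1 - u)^-1] through the Cayley transform. *)

Require Import Defs.
From mathcomp Require Import all_boot all_order all_algebra.
From mathcomp Require Import all_classical all_reals all_analysis.
From mathcomp Require Import complex ring lra.

Set Implicit Arguments.
Unset Strict Implicit.
Unset Printing Implicit Defensive.

Import Order.TTheory GRing.Theory Num.Theory.
Import numFieldNormedType.Exports.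

Local Open Scope classical_set_scope.
Local Open Scope ring_scope.
Local Open Scope complex_scope.

(** * Uniform approximation on a segment *)

Section RealApproximation.
Variable R : realType.
Implicit Types (f g h : R -> R) (M e : R).

(** The calculus takes one element at a time, so a commuting pair [b], [b'] cannot be treated by
    functions of two variables. The pair is compared inside [A] itself, through positivity, and the
    link between its members is that a product of commuting positive elements is positive. This is
    where the exponents [2^k] come from: the factorization [y^2 - x^2 = (y + x) (y - x)] lets one
    cancel [y + x] and halve the exponent, and squaring acts on the sum and the product of a
    commuting pair by fixed formulas. The lower bound 1 makes the cancelled factors invertible. In
    the construction of the calculus the crux is the bound of [|p(a)|] by the supremum of [|p|] on
    the spectrum. The C*-identity reduces it to a self-adjoint element, whose norm must then be
    found in its spectrum; Weierstrass, Tietze and completeness do the rest. *)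

Definition approximable (K : set (R -> R)) M f :=
  forall e, 0 < e -> exists2 g, K g & forall x, `|x| <= M -> `|f x - g x| <= e.

Lemma uniformly_continuous_segment f M e : continuous f -> 0 < e ->
  exists2 d, 0 < d &
    forall x y, `|x| <= M -> `|x - y| < d -> `|f x - f y| < e.
Proof.
move=> cf e0.
have /compact_near_coveringP cov := @segment_compact R (- M) M.
have := cov R (0%R^'+) (fun d x => forall y, `|x - y| < d -> `|f x - f y| < e) _.
case=> [x _|d /= d0 dP].
  have /cvgrPdist_lt /(_ _ (divr_gt0 e0 (ltr0Sn R 1))) := cf x.
  move=> /nbhs_normP[r /= r0 rP].
  exists ([set x' | `|x - x'| < r / 2], [set d | d < r / 2]); first split=> /=.
  - by apply/nbhs_normP; exists (r / 2) => //=; lra.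
  - by apply: nbhs_right_lt; lra.
  - move=> [x' d] /= [x'r dr] y x'y.
    have H z : `|x - z| < r -> `|f x - f z| < e / 2 := rP z.
    have h1 : `|f x - f y| < e / 2.
      by apply: H; rewrite (le_lt_trans (ler_distD x' _ _)) // (splitr r) ltrD // (lt_trans x'y).
    have h2 : `|f x - f x'| < e / 2 by apply: H; lra.
    have -> : f x' - f y = (f x - f y) - (f x - f x') by lra.
    by apply: le_lt_trans (ler_normB _ _) _; lra.
exists (d / 2); first by rewrite divr_gt0.
move=> x y xM xy; apply: (dP (d / 2)) => //=; rewrite ?sub0r ?normrN ?gtr0_norm; try lra.
by rewrite in_itv /= -ler_norml.
Qed.

Lemma bounded_segment f M : continuous f ->
  exists2 B, 0 < B & forall x, `|x| <= M -> `|f x| <= B.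
Proof.
move=> cf; have [M0|M0] := ltP M 0.
  by exists 1 => // x /(le_trans (normr_ge0 x)); rewrite leNgt M0.
have MM : - M <= M by lra.
have cnf : {within `[- M, M], continuous (fun x => `|f x|)}.
  apply: continuous_subspaceT => x; apply: continuous_comp; first exact: cf.
  exact: norm_continuous.
have [c _ cP] := EVT_max MM cnf.
exists (`|f c| + 1); first by have := normr_ge0 (f c); lra.
move=> x xM; apply: le_trans (cP x _) _; last by lra.
by rewrite in_itv /= -ler_norml.
Qed.

Lemma finite_net M d : 0 < d -> exists s : seq R,
  (forall t, t \in s -> `|t| <= M) /\
  (forall x, `|x| <= M -> exists2 t, t \in s & `|x - t| <= d).
Proof.
move=> d0.
pose s := [seq - M + d * i%:R | i <- iota 0 (Num.truncn (2 * M / d)).+1].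
exists [seq t <- s | `|t| <= M]; split=> [t|x xM]; first by rewrite mem_filter => /andP[].
have /andP[x1 x2] : - M <= x <= M by rewrite -ler_norml.
have q0 : 0 <= (x + M) / d by apply: divr_ge0; lra.
have /andP[] := Num.Theory.truncn_itv q0.
set i := Num.truncn _; rewrite ler_pdivlMr // ltr_pdivrMr // => i1 i2.
exists (- M + d * i%:R).
  rewrite mem_filter; apply/andP; split.
    rewrite ler_norml; apply/andP; split; last by lra.
    by rewrite lerDl mulr_ge0 // ltW.
  apply/mapP; exists i => //; rewrite mem_iota /= add0n ltnS.
  apply: Num.Theory.le_truncn; rewrite ler_pM2r ?invr_gt0 //; lra.
rewrite ler_norml; apply/andP; split; first by lra.
by move: i2; rewrite -natr1 mulrDl; lra.
Qed.

Lemma max_of_family (K : set (R -> R)) (g : R -> R -> R) (s : seq R) :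
  (forall h h', K h -> K h' -> K (fun x => Num.max (h x) (h' x))) ->
  (forall t, K (g t)) -> s != [::] ->
  exists2 h, K h & (forall t x, t \in s -> g t x <= h x) /\
    (forall x B, (forall t, t \in s -> g t x <= B) -> h x <= B).
Proof.
move=> Kmax Kg; elim: s => // t [|t' s] IH _.
  exists (g t) => //; split=> [t'' x|x B HB]; last by apply: HB; rewrite inE.
  by rewrite inE => /eqP ->.
have [h Kh [h1 h2]] := IH isT.
exists (fun x => Num.max (g t x) (h x)); first exact: Kmax.
split=> [u x|x B HB].
  rewrite inE => /orP[/eqP ->|us]; rewrite le_max ?lexx //.
  by rewrite h1 ?orbT.
by rewrite ge_max HB ?mem_head //= h2 // => u us; apply: HB; rewrite inE us orbT.
Qed.

(* [f] is nearly the maximum of the functions [f t - L * h (x - t)] over a fine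
   net: for large [L] each of them exceeds [f] only where [f t <= f x]. *)
Lemma approximable_max (K : set (R -> R)) f h M :
  (forall k k', K k -> K k' -> K (fun x => Num.max (k x) (k' x))) ->
  (forall c L t, 0 <= L -> K (fun x => c - L * h (x - t))) ->
  (forall u, 0 <= h u <= `|u|) ->
  (forall t x, f t <= f x \/ `|x - t| <= h (x - t)) ->
  continuous f -> 0 <= M -> approximable K M f.
Proof.
move=> Kmax Kh hle hf cf M0 e e0.
have [B B0 fB] := bounded_segment M cf.
have [d d0 fd] := uniformly_continuous_segment M cf (divr_gt0 e0 (ltr0Sn R 1)).
(* At distance [d] the penalty [L * d = 2 * B] already outweighs the oscillation of [f] on the
   segment. The mesh [r] is below [d] and keeps the penalty at the nearest node, at most [L * r],
   within [e / 2]. *)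
pose L := 2 * B / d; have L0 : 0 < L by rewrite divr_gt0 ?mulr_gt0.
pose r := Num.min (d / 2) (e / (2 * L)).
have r0 : 0 < r by rewrite lt_min (divr_gt0 d0) //= divr_gt0 // mulr_gt0.
have rd : r < d by rewrite gt_min; apply/orP; left; lra.
have rL : L * r <= e / 2.
  rewrite mulrC -ler_pdivlMr //; apply: (@le_trans _ _ (e / (2 * L))).
    by rewrite ge_min lexx orbT.
  by rewrite invfM mulrA.
have [s [sM sP]] := finite_net M r0.
have s0 : s != [::].
  have [|t + _] := sP 0; first by rewrite normr0.
  by case: (s).
have [k Kk [k1 k2]] := max_of_family (K := K)
  (g := fun t x => f t - L * h (x - t)) Kmax (fun t => Kh _ _ _ (ltW L0)) s0.
exists k => // x xM; rewrite ler_norml; apply/andP; split.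
- suff : k x <= f x + e by lra.
  apply: k2 => t ts.
  have /andP[h0 _] := hle (x - t).
  have Lh : 0 <= L * h (x - t) by rewrite mulr_ge0 // ltW.
  have [|hxt] := hf t x; first by lra.
  have [xtd|xtd] := ltP `|x - t| d.
    by have := fd x t xM xtd; rewrite ltr_norml => /andP[]; lra.
  have : L * d <= L * h (x - t) by rewrite ler_pM2l //; exact: le_trans hxt.
  have -> : L * d = 2 * B by rewrite /L divfK ?gt_eqF.
  have := fB t (sM t ts); have := fB x xM; rewrite !ler_norml.
  by move=> /andP[? ?] /andP[? ?]; lra.
- have [t ts xt] := sP x xM.
  have := k1 t x ts; have /andP[_ hr] := hle (x - t).
  have : L * h (x - t) <= L * r by rewrite ler_pM2l //; exact: le_trans xt.
  have := fd x t xM (le_lt_trans xt rd); rewrite ltr_norml => /andP[]; lra.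
Qed.

(** * Polynomial approximation *)

Definition polynomial_function : set (R -> R) :=
  [set f | exists p : {poly R}, forall x, f x = p.[x]].

Lemma poly_bounded (p : {poly R}) M :
  exists2 B, 0 < B & forall x, `|x| <= M -> `|p.[x]| <= B.
Proof. by apply: bounded_segment => x; exact: continuous_horner. Qed.

(* The Newton-like iteration [q + (x ^+ 2 - q ^+ 2) / 2] converges to [`|x|] on
   [-1, 1]. *)
Lemma approximable_norm1 : approximable polynomial_function 1 Num.norm.
Proof.
move=> e e0.
pose q := fix q n : {poly R} :=
  if n is m.+1 then q m + 2^-1 *: ('X ^+ 2 - q m ^+ 2) else 0.
(* With [t] the absolute value of [x], the error [s = t - q] becomes
   [s * (1 - (t + q) / 2) <= s * (1 - s / 2)], a recursion whose solutions decay like [2 / n]. *)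
have qP n x : `|x| <= 1 ->
    0 <= (q n).[x] <= `|x| /\ (`|x| - (q n).[x]) * n.+1%:R <= 2.
  move=> x1; elim: n => [|n [/andP[q0 qx] IH]].
    by rewrite /= horner0 subr0 lexx normr_ge0 mulr1; split=> //; lra.
  rewrite /= !hornerE -real_normK ?num_real //.
  move: q0 qx IH; rewrite -[n.+2%:R]natr1.
  have m1 : 1 <= n.+1%:R :> R by rewrite ler1n.
  move: (q n).[x] `|x| x1 (normr_ge0 x) m1 => y t; move: (n.+1%:R : R) => m *.
  split; first by nra.
  have ->: t - (y + 2^-1 * (t * t - y * y)) = (t - y) * (1 - (t + y) / 2).
    by field.
  nra.
have [n] : exists n, 2 / e < n.+1%:R.
  have e2 : 0 <= 2 / e by rewrite divr_ge0 // ltW.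
  by exists (Num.truncn (2 / e)); have /andP[] := Num.Theory.truncn_itv e2.
rewrite ltr_pdivrMr // => ne.
exists (fun x => (q n).[x]); first by exists (q n).
move=> x x1; have [/andP[q0 qx] qn] := qP n x x1.
rewrite ger0_norm ?subr_ge0 //.
have n0 : 0 < n.+1%:R :> R by [].
rewrite -(ler_pM2r n0) (le_trans qn) // ltW //; lra.
Qed.

Lemma approximable_approximable K M f :
  approximable (approximable K M) M f -> approximable K M f.
Proof.
move=> Kf e e0; have e2 : 0 < e / 2 by lra.
have [g Kg fg] := Kf _ e2; have [k Kk gk] := Kg _ e2; exists k => // x xM.
have := fg x xM; have := gk x xM; rewrite !ler_norml.
by move=> /andP[? ?] /andP[? ?]; apply/andP; split; lra.
Qed.

(** Dividing by a bound [B] of the approximating polynomial brings its values into [-1, 1], where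
    [approximable_norm1] applies; multiplying back by [B] explains the tolerance [e / 2 / B]. *)
Lemma approximable_poly_norm M f : approximable polynomial_function M f ->
  approximable polynomial_function M (fun x => `|f x|).
Proof.
move=> Kf e e0; have e2 : 0 < e / 2 by lra.
have [g [p gp] fp] := Kf _ e2.
have [B B0 pB] := poly_bounded p M.
have [k [q kq] aq] := approximable_norm1 (divr_gt0 e2 B0).
exists (fun x => (B *: (q \Po (B^-1 *: p))).[x]); first by exists (B *: (q \Po (B^-1 *: p))).
move=> x xM; rewrite hornerZ horner_comp hornerZ.
have := fp x xM; rewrite gp => fpx.
have := aq (B^-1 * p.[x]); rewrite normrM gtr0_norm ?invr_gt0 // kq.
rewrite mulrC ler_pdivrMr // mul1r => /(_ (pB x xM)).
have -> : `|p.[x]| / B - q.[B^-1 * p.[x]] = (`|p.[x]| - B * q.[B^-1 * p.[x]]) / B.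
  by rewrite mulrBl mulrAC divff ?mul1r ?gt_eqF.
rewrite normrM (gtr0_norm (_ : 0 < B^-1)) ?invr_gt0 // ler_pM2r ?invr_gt0 //.
move: (B * _) => y aqx.
have := ler_dist_dist (f x) p.[x].
have -> : `|f x| - y = (`|f x| - `|p.[x]|) + (`|p.[x]| - y) by lra.
by move=> h; apply: le_trans (ler_normD _ _) _; lra.
Qed.

Lemma approximableD M f g : approximable polynomial_function M f ->
  approximable polynomial_function M g ->
  approximable polynomial_function M (fun x => f x + g x).
Proof.
move=> Kf Kg e e0; have e2 : 0 < e / 2 by lra.
have [k [p pE] fp] := Kf _ e2; have [k' [q qE] gq] := Kg _ e2.
exists (fun x => (p + q).[x]); first by exists (p + q).
move=> x xM; rewrite hornerD; have := fp x xM; have := gq x xM.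
rewrite pE qE !ler_norml => /andP[? ?] /andP[? ?]; apply/andP; split; lra.
Qed.

Lemma approximableZ M f c : approximable polynomial_function M f ->
  approximable polynomial_function M (fun x => c * f x).
Proof.
move=> Kf e e0; have c0 : 0 < `|c| + 1 by have := normr_ge0 c; lra.
have [k [p pE] fp] := Kf _ (divr_gt0 e0 c0).
exists (fun x => (c *: p).[x]); first by exists (c *: p).
move=> x xM; rewrite hornerZ -mulrBr normrM.
have := fp x xM; rewrite pE ler_pdivlMr //.
by have := normr_ge0 (f x - p.[x]); have := normr_ge0 c; nra.
Qed.

Lemma approximable_polyfun M f :
  polynomial_function f -> approximable polynomial_function M f.
Proof. by move=> Kf e e0; exists f => // x _; rewrite subrr normr0 ltW. Qed.

Lemma maxr_norm (x y : R) : Num.max x y = 2^-1 * (x + y + `|x - y|).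
Proof.
by case: (leP x y) => xy; [rewrite ler0_norm|rewrite gtr0_norm]; lra.
Qed.

(** Polynomials are not stable under maxima, but their uniform closure on the segment is, since it
    contains the absolute value of each of its members. The net argument is therefore run in the
    closure. *)
Theorem weierstrass f M : continuous f -> approximable polynomial_function M f.
Proof.
move=> cf; have [M0|M0] := ltP M 0.
  move=> e _; exists (fun=> 0); first by exists 0 => x; rewrite horner0.
  by move=> x /(le_trans (normr_ge0 x)); rewrite leNgt M0.
apply: approximable_approximable.
apply: (@approximable_max _ _ Num.norm) => // [k k' Kk Kk'|c L t L0|u|t x].
- have -> : (fun x => Num.max (k x) (k' x)) =
      fun x => 2^-1 * ((k x + k' x) + `|k x + -1 * k' x|).
    by apply/funext => x; rewrite maxr_norm mulN1r.
  apply: approximableZ; apply: approximableD; first exact: approximableD.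
  apply: approximable_poly_norm; apply: approximableD => //.
  exact: approximableZ.
- have -> : (fun x => c - L * `|x - t|) = fun x => c + - L * `|x - t|.
    by apply/funext => x; rewrite mulNr.
  apply: approximableD.
    by apply: approximable_polyfun; exists c%:P => x; rewrite hornerC.
  apply: approximableZ; apply: approximable_poly_norm.
  apply: approximable_polyfun; exists ('X - t%:P) => x.
  by rewrite hornerXsubC.
- by rewrite normr_ge0 lexx.
- by right.
Qed.

(** A cone offers no subtraction, so the penalty must be one-sided: [c - L * max (t - x) 0] is
    [c + L * min (x - t) 0]. Where it vanishes, [t <= x] and isotony gives [f t <= f x]. *)
Theorem isotone_approximation (K : set (R -> R)) f M :
  continuous f -> {homo f : x y / x <= y} -> 0 <= M ->
  (forall c, K (fun=> c)) -> K id ->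
  (forall k k', K k -> K k' -> K (fun x => k x + k' x)) ->
  (forall c k, 0 <= c -> K k -> K (fun x => c * k x)) ->
  (forall k k', K k -> K k' -> K (fun x => Num.max (k x) (k' x))) ->
  (forall k k', K k -> K k' -> K (fun x => Num.min (k x) (k' x))) ->
  approximable K M f.
Proof.
move=> cf hf M0 Kc Kid KD KZ Kmax Kmin.
apply: (@approximable_max _ _ (fun u => Num.max (- u) 0)) => // [c L t L0|u|t x].
- have -> : (fun x => c - L * Num.max (- (x - t)) 0) =
      fun x => c + L * Num.min (x + - t) 0.
    apply/funext => x; congr (_ + _); rewrite -mulrN; congr (_ * _).
    by case: (leP (- (x - t)) 0) => ?; case: (leP (x - t) 0) => ?; lra.
  by apply: (KD _ _ (Kc c)); apply: KZ => //; apply: Kmin => //; exact: KD.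
- rewrite le_max lexx orbT /= ge_max normr_ge0 andbT.
  by rewrite -normrN ler_norm.
- have [/hf ?|xt] := leP t x; first by left.
  by right; rewrite le_max ltr0_norm ?lexx // subr_lt0.
Qed.

End RealApproximation.

(** * Norms and spectra in a C*-algebra *)

Section RealNorm.
Variable R : realType.

(** A norm with values in [R] rather than [R[i]], so that estimates become real arithmetic. *)
Definition nrm {V : normedZmodType R[i]} (x : V) : R := complex.Re `|x|.

Lemma nrmE {V : normedZmodType R[i]} (x : V) : `|x| = (nrm x)%:C.
Proof. by rewrite /nrm RRe_real // normr_real. Qed.

Lemma nrm_le {V : normedZmodType R[i]} (x : V) (e : R) :
  (`|x| <= e%:C) = (nrm x <= e).
Proof. by rewrite nrmE lecR. Qed.

Lemma nrm_lt {V : normedZmodType R[i]} (x : V) (e : R) :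
  (`|x| < e%:C) = (nrm x < e).
Proof. by rewrite nrmE ltcR. Qed.

Lemma nrm_ge0 {V : normedZmodType R[i]} (x : V) : 0 <= nrm x.
Proof. by rewrite -lecR -nrmE normr_ge0. Qed.

Lemma nrm0 {V : normedZmodType R[i]} : nrm (0 : V) = 0.
Proof. by rewrite /nrm normr0. Qed.

Lemma nrm_eq0 {V : normedZmodType R[i]} (x : V) : (nrm x == 0) = (x == 0).
Proof. by rewrite -(inj_eq (@complexI R)) -nrmE normr_eq0. Qed.

Lemma nrmN {V : normedZmodType R[i]} (x : V) : nrm (- x) = nrm x.
Proof. by rewrite /nrm normrN. Qed.

Lemma nrm_distC {V : normedZmodType R[i]} (x y : V) : nrm (x - y) = nrm (y - x).
Proof. by rewrite /nrm distrC. Qed.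

Lemma nrmD {V : normedZmodType R[i]} (x y : V) : nrm (x + y) <= nrm x + nrm y.
Proof. by rewrite -nrm_le rmorphD /= -!nrmE ler_normD. Qed.

Lemma nrmB {V : normedZmodType R[i]} (x y : V) : nrm (x - y) <= nrm x + nrm y.
Proof. by rewrite -(nrmN y) nrmD. Qed.

Lemma nrm_dist {V : normedZmodType R[i]} (z x y : V) :
  nrm (x - y) <= nrm (x - z) + nrm (z - y).
Proof. by rewrite -nrm_le rmorphD /= -!nrmE ler_distD. Qed.

Lemma nrm_small {V : normedZmodType R[i]} (x : V) (C : R) :
  (forall e, 0 < e -> nrm x <= C * e) -> x = 0.
Proof.
move=> H; apply/eqP; rewrite -nrm_eq0 eq_le nrm_ge0 andbT.
apply/ler_addgt0Pl => e e0; rewrite addr0.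
have C1 : 0 < `|C| + 1 by have := normr_ge0 C; lra.
apply: le_trans (H _ (divr_gt0 e0 C1)) _.
rewrite mulrCA ler_piMr ?(ltW e0) // ler_pdivrMr // mul1r.
by have := ler_norm C; lra.
Qed.

Lemma nrm_real (x : R) : nrm (x%:C : R[i]) = `|x|.
Proof. by rewrite /nrm normc_def /= expr0n /= addr0 sqrtr_sqr. Qed.

Lemma nrmMc (x y : R[i]) : nrm (x * y) = nrm x * nrm y.
Proof. by apply: (@complexI R); rewrite rmorphM /= -!nrmE normrM. Qed.

Lemma nrmc1 : nrm (1 : R[i]) = 1.
Proof. by rewrite /nrm normr1. Qed.

Lemma nrmi : nrm ('i%C : R[i]) = 1.
Proof. by rewrite /nrm normc_def /= expr0n /= add0r expr1n sqrtr1. Qed.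

Lemma nrm_conj (z : R[i]) : nrm (z^*) = nrm z.
Proof. by rewrite /nrm normcJ. Qed.

Lemma normr_Re_le (z : R[i]) : `|complex.Re z| <= nrm z.
Proof. by rewrite -lecR -nrmE normc_ge_Re. Qed.

Lemma normr_Im_le (z : R[i]) : `|complex.Im z| <= nrm z.
Proof.
by rewrite -[complex.Im z]opprK -ReiNIm normrN (le_trans (normr_Re_le _)) // nrmMc nrmi mulr1.
Qed.

Lemma expr_small (q e : R) : 0 <= q < 1 -> 0 < e ->
  exists N, forall n, (N <= n)%N -> q ^+ n <= e.
Proof.
move=> /andP[q0 q1] e0.
have : (GRing.exp q) @ \oo --> (0 : R) by apply: cvg_expr; rewrite ger0_norm.
move=> /cvgrPdist_le /(_ e e0) [N _ HN]; exists N => n Nn.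
by have := HN n Nn; rewrite /= sub0r normrN ger0_norm // exprn_ge0.
Qed.

End RealNorm.

Section CStarBasics.
Variables (R : realType) (A : cstarAlgType R).
Implicit Types (a b x y : A) (z c : R[i]) (I : set A).

Lemma nrmZ c x : nrm (c *: x) = nrm c * nrm x.
Proof. by apply: (@complexI R); rewrite rmorphM /= -!nrmE normrZ. Qed.

Lemma nrmZr (r : R) x : nrm (r%:C *: x) = `|r| * nrm x.
Proof. by rewrite nrmZ nrm_real. Qed.

Lemma nrmM x y : nrm (x * y) <= nrm x * nrm y.
Proof. by rewrite -nrm_le rmorphM /= -!nrmE cstar_normM_le. Qed.

Lemma nrm_starM x : nrm (star x * x) = nrm x ^+ 2.
Proof. by apply: (@complexI R); rewrite rmorphXn /= -!nrmE cstar_identity. Qed.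

Lemma star0 : star (0 : A) = 0.
Proof. by apply: (addIr (star 0)); rewrite -starD !add0r. Qed.

Lemma starN x : star (- x) = - star x.
Proof. by apply/eqP; rewrite -addr_eq0 -starD addNr star0. Qed.

Lemma starB x y : star (x - y) = star x - star y.
Proof. by rewrite starD starN. Qed.

Lemma star1 : star (1 : A) = 1.
Proof. by have := starM (star 1) (1 : A); rewrite mulr1 starK mulr1. Qed.

Lemma starX x n : star (x ^+ n) = star x ^+ n.
Proof. by elim: n => [|n IH]; rewrite ?star1 // exprS starM IH -exprSr. Qed.

Lemma starZr (r : R) x : star (r%:C *: x) = r%:C *: star x.
Proof. by rewrite starZ; congr (_ *: _); exact: conjc_real. Qed.

Lemma starZi (r : R) x : star ((r%:C * 'i%C) *: x) = - ((r%:C * 'i%C) *: star x).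
Proof.
rewrite starZ -scaleNr; congr (_ *: _); apply/eqP.
by rewrite eq_complex /= !(mulr0,mul0r,mulr1,add0r,subr0,oppr0,addr0) !eqxx.
Qed.

(** The C*-identity and submultiplicativity give [|y|^2 <= |star y| |y|]; cancelling [|y|] and
    applying this to [x] and [star x] gives both inequalities. *)
Lemma nrm_star x : nrm (star x) = nrm x.
Proof.
have H y : nrm y <= nrm (star y).
  have [->|y0] := eqVneq y 0; first by rewrite star0 nrm0.
  have ny : 0 < nrm y by rewrite lt_neqAle nrm_ge0 eq_sym nrm_eq0 y0.
  by rewrite -(ler_pM2r ny) -expr2 -nrm_starM nrmM.
by apply/eqP; rewrite eq_le H -{2}(starK x) H.
Qed.

Lemma nrm1 : nrm (1 : A) = 1.
Proof.
have := nrm_starM 1; rewrite star1 mulr1 => /eqP.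
rewrite expr2 -subr_eq0 -{1}(mulr1 (nrm (1 : A))) -mulrBr mulf_eq0 nrm_eq0 oner_eq0 /=.
by rewrite subr_eq0 => /eqP.
Qed.

Lemma nrm_exp x n : nrm (x ^+ n) <= nrm x ^+ n.
Proof.
elim: n => [|n IH]; first by rewrite !expr0 nrm1.
by rewrite !exprS (le_trans (nrmM _ _)) // ler_wpM2l // nrm_ge0.
Qed.

Lemma nrm_sa_sq x : star x = x -> nrm (x ^+ 2) = nrm x ^+ 2.
Proof. by move=> sx; rewrite expr2 -{1}sx nrm_starM. Qed.

Lemma nrm_complete (u : nat -> A) :
  (forall e : R, 0 < e -> exists N, forall n, (N <= n)%N -> nrm (u n - u N) <= e) ->
  exists l, forall e : R, 0 < e ->
    exists N, forall n, (N <= n)%N -> nrm (l - u n) <= e.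
Proof.
move=> cu; have /cauchy_cvgP cvu : cauchy (u @ \oo).
  apply/cauchy_exP => e; rewrite ltcE /= => /andP[/eqP e1 e2].
  have [N HN] := cu _ (divr_gt0 e2 (ltr0Sn R 1)).
  exists (u N), N => // n /= Nn; rewrite -ball_normE /ball_ /=.
  have -> : e = (complex.Re e)%:C by apply/eqP; rewrite eq_complex /= e1 !eqxx.
  by rewrite nrm_lt nrm_distC (le_lt_trans (HN n Nn)) //; lra.
exists (lim (u @ \oo)) => e e0.
have /cvgrPdist_le /(_ e%:C) [|N _ HN] := cvu; first by rewrite ltcR.
by exists N => n Nn; rewrite -nrm_le; exact: HN.
Qed.

Lemma closed_nrm I x : closed I ->
  (forall e : R, 0 < e -> exists2 y, I y & nrm (x - y) <= e) -> I x.
Proof.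
move=> cI H; apply: cI => B /nbhs_normP[e /=]; rewrite ltcE /= => /andP[/eqP e1 e2] eB.
have [y Iy xy] := H _ (divr_gt0 e2 (ltr0Sn R 1)).
exists y; split=> //; apply: eB; rewrite /ball_ /=.
have -> : e = (complex.Re e)%:C by apply/eqP; rewrite eq_complex /= e1 !eqxx.
by rewrite nrm_lt (le_lt_trans xy) //; lra.
Qed.

(** Shaped so that [spectrum a z] unfolds to [~ invertible (z *: 1 - a)]. *)
Definition invertible x := exists y, x * y = 1 /\ y * x = 1.

Lemma invertibleM x y : invertible x -> invertible y -> invertible (x * y).
Proof.
move=> [x' [xx' x'x]] [y' [yy' y'y]]; exists (y' * x'); split.
  by rewrite mulrA -(mulrA x) yy' mulr1.
by rewrite mulrA -(mulrA y') x'x mulr1.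
Qed.

Lemma invertibleZ c x : c != 0 -> invertible x -> invertible (c *: x).
Proof.
move=> c0 [y [xy yx]]; exists (c^-1 *: y).
by rewrite -!scalerAr -!scalerAl xy yx !scalerA mulVf ?mulfV // scale1r.
Qed.

Lemma inverse_comm x y w : x * y = 1 -> y * x = 1 -> x * w = w * x -> y * w = w * y.
Proof.
by move=> xy yx xw; rewrite -[LHS]mulr1 -xy mulrA -(mulrA y) -xw mulrA yx mul1r.
Qed.

Lemma mulr_sub_add_comm x y : x * y = y * x ->
  (x - y) * (x + y) = x ^+ 2 - y ^+ 2 /\ (x + y) * (x - y) = x ^+ 2 - y ^+ 2.
Proof.
move=> xy; split.
  by rewrite mulrDr !mulrBl xy addrA subrK !expr2.
by rewrite mulrBr !mulrDl xy opprD addrA addrK !expr2.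
Qed.

Lemma sqr_add_sub_comm x y : x * y = y * x ->
  (x + y) * (x + y) - (x - y) * (x - y) = (x * y) *+ 4.
Proof.
move=> xy; rewrite mulrBr !mulrBl mulrDr !mulrDl -xy !opprD !opprK.
rewrite addrACA [X in X + _]addrACA subrr add0r [X in _ + X]addrACA subrr addr0.
by rewrite -!mulr2n -mulrnA.
Qed.

Lemma neumann x : nrm x < 1 -> invertible (1 - x).
Proof.
move=> x1; set q := nrm x in x1; have q0 : 0 <= q := nrm_ge0 x.
have q1 : 0 < 1 - q by lra.
pose u n := \sum_(k < n) x ^+ k.
have uS n : u n.+1 = u n + x ^+ n by rewrite /u big_ord_recr.
have uE n : (1 - x) * u n = 1 - x ^+ n.
  elim: n => [|n IH]; first by rewrite /u big_ord0 mulr0 expr0 subrr.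
  by rewrite uS mulrDr IH mulrBl mul1r -exprS addrA subrK.
have uC n : u n * (1 - x) = 1 - x ^+ n.
  elim: n => [|n IH]; first by rewrite /u big_ord0 mul0r expr0 subrr.
  by rewrite uS mulrDl IH mulrBr mulr1 -exprSr addrA subrK.
have uD n k : nrm (u (k + n)%N - u n) * (1 - q) <= q ^+ n - q ^+ (k + n).
  elim: k => [|k IH]; first by rewrite !add0n !subrr nrm0 mul0r.
  rewrite addSn uS addrAC.
  have := nrmD (u (k + n)%N - u n) (x ^+ (k + n)).
  have := nrm_exp x (k + n); rewrite -/q exprS; nra.
have [|l ul] := @nrm_complete u.
  move=> e e0; have qe : 0 < e * (1 - q) by rewrite mulr_gt0.
  have [|N HN] := @expr_small R q (e * (1 - q)) _ qe; first by rewrite q0 x1.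
  exists N => n Nn; have := uD N (n - N)%N; rewrite subnK //.
  have := HN N (leqnn N); have := exprn_ge0 n q0; rewrite -[nrm _ <= e](ler_pM2r q1); lra.
have xl e : 0 < e -> exists2 n, nrm (l - u n) <= e & nrm (x ^+ n) <= e.
  move=> e0; have [N HN] := ul e e0.
  have [|N' HN'] := @expr_small R q e _ e0; first by rewrite q0 x1.
  exists (maxn N N'); first by apply: HN; rewrite leq_maxl.
  by apply: le_trans (nrm_exp _ _) (HN' _ _); rewrite leq_maxr.
exists l; split; apply/eqP; rewrite -subr_eq0; apply/eqP;
  apply: (@nrm_small _ _ _ (nrm (1 - x) + 1)) => e e0;
  have [n ln xn] := xl e e0.
  have -> : (1 - x) * l - 1 = (1 - x) * (l - u n) - x ^+ n.
    by rewrite mulrBr uE opprB addrA addrAC addrK.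
  apply: le_trans (nrmB _ _) _; rewrite [X in _ <= X]mulrDl mul1r lerD //.
  by rewrite (le_trans (nrmM _ _)) // ler_wpM2l // nrm_ge0.
have -> : l * (1 - x) - 1 = (l - u n) * (1 - x) - x ^+ n.
  by rewrite mulrBl uC opprB addrA addrAC addrK.
apply: le_trans (nrmB _ _) _; rewrite [X in _ <= X]mulrDl mul1r lerD //.
by rewrite (le_trans (nrmM _ _)) // mulrC ler_wpM2l // nrm_ge0.
Qed.

Lemma invertible_scalar_sub z x : nrm x < nrm z -> invertible (z *: 1 - x).
Proof.
move=> xz; have z0 : z != 0 by rewrite -nrm_eq0 gt_eqF // (le_lt_trans (nrm_ge0 x)).
have -> : z *: 1 - x = z *: (1 - z^-1 *: x).
  by rewrite scalerBr scalerA mulfV // scale1r.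
apply: invertibleZ => //; apply: neumann; rewrite nrmZ.
have nz : 0 < nrm z by rewrite (le_lt_trans (nrm_ge0 x)).
have zz : nrm z^-1 * nrm z = 1 by rewrite -nrmMc mulVf // nrmc1.
by rewrite -(ltr_pM2r nz) mul1r mulrAC zz mul1r.
Qed.

(* Shifting by [t i] with [t = |x|^2] makes the Neumann series converge, since
   [|x + t i|^2 <= |x|^2 + t^2 < (1 + t)^2]. *)
Lemma invertible_i_sub x : star x = x -> invertible ('i%C *: 1 - x).
Proof.
move=> sx; set t := nrm x ^+ 2; have t0 : 0 <= t by rewrite exprn_ge0 // nrm_ge0.
pose y := x + (t%:C * 'i%C) *: 1.
have -> : 'i%C *: 1 - x = ((1 + t)%:C * 'i%C) *: 1 - y.
  by rewrite /y opprD addrCA -addrC -scalerBl rmorphD /= mulrDl addrK mul1r addrC.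
apply: invertible_scalar_sub; rewrite nrmMc nrmi mulr1 nrm_real ger0_norm; last lra.
rewrite -(@ltr_pXn2r _ 2) ?nnegrE ?nrm_ge0 //; last lra.
have -> : nrm y ^+ 2 = nrm (x ^+ 2 + (t ^+ 2)%:C *: 1).
  rewrite -nrm_starM /y starD sx starZi star1; set c := t%:C * 'i%C.
  have xc : x * c%:A = c%:A * x by rewrite mulr_algr mulr_algl.
  have [-> _] := mulr_sub_add_comm xc.
  rewrite [in X in _ - X]expr2 mulr_algl scalerA -scaleNr /c.
  congr (nrm (_ + _ *: _)).
  rewrite mulrACA -!expr2 sqr_i mulrN1 opprK.
  exact/esym/rmorphXn.

apply: le_lt_trans (nrmD _ _) _.
rewrite nrm_sa_sq // nrmZr nrm1 mulr1 ger0_norm ?exprn_ge0 ?nrm_ge0 // -/t.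
nra.
Qed.

(** For [z = r + s i] with [s] nonzero, [z - x = s (i - s^-1 (x - r))], which reduces to the case of
    [i]. *)
Lemma spectrum_real x z : star x = x -> spectrum x z -> z = (complex.Re z)%:C.
Proof.
case: z => r s sx /= xz; have [-> //|s0] := eqVneq s 0.
case: xz; set z := r +i* s.
have -> : z *: 1 - x = s%:C *: ('i%C *: 1 - s^-1%:C *: (x - r%:C *: 1)).
  rewrite scalerBr !scalerA -rmorphM /= mulfV // scale1r opprB addrA -scalerDl.
  congr (_ *: _ - _); apply/eqP.
  by rewrite eq_complex /= !(mulr0,mul0r,mulr1,add0r,subr0,oppr0,addr0) !eqxx.
apply: invertibleZ; first by rewrite eq_complex /= negb_and s0.
by apply: invertible_i_sub; rewrite starZr starB starZr star1 sx.
Qed.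

(* [x (1 + x^2)^-1] is half the imaginary part of the unitary
   [(x + i) (x - i)^-1]. *)
Lemma cayley_bound x : star x = x -> exists y,
  [/\ (1 + x ^+ 2) * y = 1, y * (1 + x ^+ 2) = 1 & nrm (x * y) <= 2^-1].
Proof.
move=> sx.
pose p := x + 'i%C *: 1; pose m := x - 'i%C *: 1.
have sp : star p = m.
  rewrite /p starD starZ star1 sx /m -scaleNr; congr (_ + _ *: _).
  by apply/eqP; rewrite eq_complex /= oppr0 !eqxx.
have sm : star m = p by rewrite -sp starK.
have xi : x * ('i%C *: 1) = 'i%C *: 1 * x by rewrite mulr_algr mulr_algl.
have [p' [pp' p'p]] : invertible p.
  have := @invertible_i_sub (- x); rewrite starN sx opprK addrC; exact.
have pm : p * m = 1 + x ^+ 2.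
  have [_ ->] := mulr_sub_add_comm xi.
  by rewrite [in X in _ - X]expr2 mulr_algl scalerA -expr2 sqr_i scaleN1r opprK addrC.
have mp : m * p = p * m by have [-> ->] := mulr_sub_add_comm xi.
have [m' [mm' m'm]] : invertible m.
  by exists (star p'); rewrite -sp -!starM pp' p'p star1.
have m'p : m' * p = p * m' by apply: inverse_comm mm' m'm mp.
have p'm : p' * m = m * p' by apply: inverse_comm pp' p'p (esym mp).
have p'm' : p' * m' = m' * p' by apply: inverse_comm pp' p'p (esym m'p).
have sp' : star p' = m'.
  have := congr1 star pp'; rewrite starM sp star1 => H.
  by rewrite -[LHS]mulr1 -mm' mulrA H mul1r.
have sm' : star m' = p' by rewrite -sp' starK.
have nc : nrm (m * p') = 1.
  apply/eqP; rewrite -(@eqrXn2 _ 2) ?nrm_ge0 // expr1n -nrm_starM starM sp' sm.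
  by rewrite mulrA -(mulrA m') -mp (mulrA m') m'm mul1r pp' nrm1.
exists (m' * p'); split.
- by rewrite -pm -mulrA (mulrA m) mm' mul1r.
- by rewrite -pm -mulrA (mulrA p') p'p mul1r.
(* By [(x + i)^2 - (x - i)^2 = 4 i x], the element [x * (m' * p')] is the difference of the unitary
   [m' * p] and its adjoint [m * p'], divided by [4 i]; both have norm 1, whence the bound
   [2 / 4]. *)
have pp_mm : p * p - m * m = (4 * 'i%C) *: x.
  by rewrite /p /m sqr_add_sub_comm // mulr_algr -scalerA -scaler_nat.
have <- : (4 * 'i%C : R[i])^-1 *: (star (m * p') - m * p') = x * (m' * p').
  have -> : star (m * p') - m * p' = (p * p - m * m) * (m' * p').
    rewrite starM sp' sm [RHS]mulrBl; congr (_ - _); last first.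
      by rewrite -mulrA (mulrA m m') mm' mul1r.
    by rewrite -p'm' -mulrA (mulrA p p') pp' mul1r m'p.
  rewrite pp_mm -scalerAl scalerA mulVf ?scale1r //.
  by rewrite mulf_neq0 ?pnatr_eq0 // eq_complex /= oner_eq0 andbF.
rewrite nrmZ.
have n4 : nrm (4 * 'i%C : R[i])^-1 * 4 = 1.
  have -> : 4 = nrm (4 * 'i%C : R[i]).
    have -> : 4 = (4 : R)%:C by rewrite rmorph_nat.
    by rewrite nrmMc nrmi mulr1 nrm_real ger0_norm.
  rewrite -nrmMc mulVf ?nrmc1 //.
  by rewrite mulf_neq0 ?pnatr_eq0 // eq_complex /= oner_eq0 andbF.
have := nrmB (star (m * p')) (m * p'); rewrite nrm_star nc.
have := nrm_ge0 (4 * 'i%C : R[i])^-1; nra.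
Qed.

(* With [u_k = (x ^+ 2) ^+ (2 ^ k)], the elements [y_k = u_k (1 - u_k)^-1] satisfy
   [y_k.+1 = y_k * u_k (1 + u_k)^-1], so they tend to 0, although [u_k] has
   norm 1. *)
Lemma norm1_sq_not_invertible x : star x = x -> nrm x = 1 ->
  ~ invertible (1 - x ^+ 2).
Proof.
move=> sx nx [r [xr rx]].
pose v k := x ^+ (2 ^ k); pose u k := v k ^+ 2.
have vS k : v k.+1 = v k ^+ 2 by rewrite /v -exprM expnSr.
have sv k : star (v k) = v k by rewrite starX sx.
have nv k : nrm (v k) = 1.
  by elim: k => [|k IH]; rewrite ?expr1 // vS nrm_sa_sq // IH expr1n.
pose C := nrm (x ^+ 2 * r).
have H k : exists2 y, u k = y * (1 - u k) & nrm y <= C * 2^-1 ^+ k.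
  elim: k => [|k [y uy ny]].
    exists (x ^+ 2 * r); last by rewrite expr0 mulr1.
    by rewrite /u /v expn0 expr1 -mulrA rx mulr1.
  have [i [i1 i2 ni]] := cayley_bound (sv k).
  exists (y * (u k * i)).
    have -> : u k.+1 = u k * u k by rewrite /u vS expr2.
    have -> : 1 - u k * u k = (1 + u k) * (1 - u k).
      by have [_ ->] := @mulr_sub_add_comm 1 (u k) (commr_sym (commr1 _)); rewrite expr1n expr2.
    rewrite -[y * _ * _]mulrA -[u k * i * _]mulrA (mulrA i) i2 mul1r.
    have -> : u k * (1 - u k) = (1 - u k) * u k by rewrite mulrBl mul1r mulrBr mulr1.
    by rewrite mulrA -uy.
  apply: le_trans (nrmM _ _) _; rewrite exprSr mulrA.
  apply: ler_pM; rewrite ?nrm_ge0 //.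
  rewrite /u expr2 -mulrA; apply: le_trans (nrmM _ _) _.
  by rewrite nv mul1r.
(* Since [u N = y * (1 - u N)] has norm 1, the norm of [y] is at least [1 / 2]; but [N] is taken so
   large that it is at most [C / (2 * C + 1) < 1 / 2]. *)
have C0 : 0 < 2 * C + 1 by have : 0 <= C := nrm_ge0 _; lra.
have h2 : 0 <= (2^-1 : R) < 1 by apply/andP; split; lra.
have Ci : 0 < (2 * C + 1)^-1 by rewrite invr_gt0.
have [N HN] := expr_small h2 Ci.
have [y uy ny] := H N.
have nu : nrm (u N) = 1 by rewrite /u nrm_sa_sq // nv expr1n.
have y2 : 1 <= nrm y * 2.
  rewrite -[1]nu {1}uy; apply: le_trans (nrmM _ _) _.
  rewrite ler_wpM2l ?nrm_ge0 //; apply: le_trans (nrmB _ _) _.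
  by rewrite nrm1 nu.
have := HN N (leqnn N); rewrite -(ler_pM2r C0) mulVf ?gt_eqF //.
have : 0 < (2^-1 : R) ^+ N by rewrite exprn_gt0 // invr_gt0.
have : 0 <= C := nrm_ge0 _.
nra.
Qed.

(** If neither [|x|] nor [- |x|] were in the spectrum, then for [y = x / |x|] both factors of
    [1 - y^2 = (1 - y) (1 + y)] would be invertible. *)
Lemma norm_in_spectrum x : star x = x ->
  exists2 t : R, `|t| = nrm x & spectrum x t%:C.
Proof.
move=> sx; have [nx|nx] := eqVneq (nrm x) 0.
  exists 0; first by rewrite normr0.
  move: nx => /eqP; rewrite nrm_eq0 => /eqP ->.
  move=> [y [+ _]]; rewrite scale0r subrr mul0r => /esym/eqP.
  by rewrite oner_eq0.
have n0 : 0 < nrm x by rewrite lt_neqAle eq_sym nx nrm_ge0.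
pose y := (nrm x)^-1%:C *: x.
have sy : star y = y by rewrite starZr sx.
have ny : nrm y = 1 by rewrite nrmZr ger0_norm ?invr_ge0 ?(ltW n0) // mulVf.
have xy : x = (nrm x)%:C *: y by rewrite scalerA -rmorphM /= divff // scale1r.
have nC : (nrm x)%:C != 0 :> R[i] by rewrite eq_complex /= negb_and nx.
apply: contrapT => /forall2NP H; apply: (norm1_sq_not_invertible sy ny).
have -> : 1 - y ^+ 2 = (1 - y) * (1 + y).
  by rewrite mulrDr mulr1 mulrBl mul1r addrA subrK expr2.
have inv (t : R) : `|t| = nrm x -> invertible (t%:C *: 1 - x).
  by move=> tx; have [//|/contrapT] := H t.
have VC c (z : A) : c != 0 -> invertible (c *: z) -> invertible z.
  move=> c0 /(invertibleZ (invr_neq0 c0)).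
  by rewrite scalerA mulVf // scale1r.
apply: invertibleM.
  apply: (VC _ _ nC); rewrite scalerBr -xy; apply: inv.
  by rewrite ger0_norm // ltW.
apply: (VC (- (nrm x)%:C)); first by rewrite oppr_eq0.
rewrite scalerDr [X in _ + X]scaleNr -xy -rmorphN; apply: inv.
by rewrite normrN ger0_norm // ltW.
Qed.

Lemma invertible_near x y r : x * r = 1 -> r * x = 1 ->
  nrm r * nrm (x - y) < 1 -> invertible y.
Proof.
move=> xr rx rxy; have -> : y = x * (1 - r * (x - y)).
  by rewrite mulrBr mulr1 mulrA xr mul1r opprB addrC subrK.
apply: invertibleM; first by exists r.
by apply: neumann; apply: le_lt_trans (nrmM _ _) rxy.
Qed.

End CStarBasics.

(** * Existence of the functional calculus *)

Section PolynomialCalculus.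
Variables (R : realType) (A : cstarAlgType R) (a : A).
Hypothesis sa : star a = a.
Implicit Types (p q : {poly R[i]}) (f g : R[i] -> R[i]).

Definition peval p : A := horner_alg a p.

Lemma pevalD p q : peval (p + q) = peval p + peval q.
Proof. exact: rmorphD. Qed.

Lemma pevalB p q : peval (p - q) = peval p - peval q.
Proof. exact: rmorphB. Qed.

Lemma pevalM p q : peval (p * q) = peval p * peval q.
Proof. exact: rmorphM. Qed.

Lemma pevalC c : peval c%:P = c *: 1.
Proof. exact: horner_algC. Qed.

Lemma pevalX : peval 'X = a.
Proof. exact: horner_algX. Qed.

Lemma pevalZ c p : peval (c *: p) = c *: peval p.
Proof. by rewrite -mul_polyC pevalM pevalC mulr_algl. Qed.

Lemma peval_comm p x : a * x = x * a -> peval p * x = x * peval p.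
Proof.
move=> ax; elim/poly_ind: p => [|p c IH].
  by rewrite /peval rmorph0 mul0r mulr0.
rewrite pevalD pevalM pevalX pevalC mulrDl mulrDr -mulrA ax mulrA IH -mulrA.
by rewrite mulr_algl mulr_algr.
Qed.

Lemma horner_conj p w : conjc w = w -> (map_poly conjc p).[w] = conjc p.[w].
Proof. by move=> wE; rewrite -[in LHS]wE horner_map. Qed.

Lemma peval_star p : peval (map_poly conjc p) = star (peval p).
Proof.
elim/poly_ind: p => [|p c IH].
  by rewrite rmorph0 /peval rmorph0 star0.
rewrite rmorphD rmorphM /= map_polyX map_polyC /= !pevalD !pevalM IH !pevalC pevalX.
rewrite starD starM sa starZ star1 -IH; congr (_ + _).
exact: peval_comm.
Qed.

Lemma spectrum_nonempty : exists t : R, spectrum a t%:C.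
Proof. by have [t _ ht] := norm_in_spectrum sa; exists t. Qed.

Lemma spectrum_bound w : spectrum a w -> nrm w <= nrm a.
Proof.
move=> aw; rewrite leNgt; apply/negP => wa.
by apply: aw; exact: invertible_scalar_sub.
Qed.

(** Over the algebraically closed field [R[i]], [p - z] splits into linear factors; if no root lay
    in the spectrum of [a], every factor would be invertible at [a], and so would their product. *)
Lemma spectrum_peval p z : spectrum (peval p) z -> exists2 w, spectrum a w & p.[w] = z.
Proof.
move=> pz; apply: contrapT => /forall2NP H; apply: pz.
have Hw w : p.[w] = z -> invertible (w *: 1 - a).
  by move=> pw; have [/contrapT|] := H w.
have -> : z *: 1 - peval p = - peval (p - z%:P) by rewrite pevalB pevalC opprB.
(* A constant [p] equal to [z] has no factorization to use; here any point of the nonempty spectrum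
   serves as [w]. *)
have [pz0|pz0] := eqVneq (p - z%:P) 0.
  have [t at_] := spectrum_nonempty; exfalso; apply: (at_ : ~ _); apply: Hw.
  by rewrite -[p](subrK z%:P) pz0 add0r hornerC.
have [r pr] := closed_field_poly_normal (p - z%:P).
have rP w : w \in r -> invertible (peval ('X - w%:P)).
  move=> wr; rewrite pevalB pevalX pevalC -opprB -scaleN1r.
  apply: invertibleZ; first by rewrite oppr_eq0 oner_eq0.
  apply: Hw; apply/eqP.
  have -> : (p.[w] == z) = root (p - z%:P) w.
    by rewrite /root hornerD hornerN hornerC subr_eq0.
  rewrite pr rootZ ?lead_coef_eq0 // root_prod_XsubC //.
rewrite -scaleN1r; apply: invertibleZ; first by rewrite oppr_eq0 oner_eq0.
rewrite pr pevalZ; apply: invertibleZ; first by rewrite lead_coef_eq0.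
elim: (r) rP => [_|w s IH rP].
  by rewrite big_nil /peval rmorph1; exists 1; rewrite mulr1.
rewrite big_cons pevalM; apply: invertibleM; first by apply: rP; rewrite mem_head.
by apply: IH => u us; apply: rP; rewrite inE us orbT.
Qed.

(** The square of the norm of [p(a)] is the norm of [star (p(a)) * p(a)], hence the modulus of a
    spectral value of it. This element is a polynomial in [a], so the value is [|p(w)|^2] for some
    [w] in the spectrum, [w] being real. *)
Lemma peval_norm_le p (B : R) :
  (forall w, spectrum a w -> nrm p.[w] <= B) -> nrm (peval p) <= B.
Proof.
move=> pB; have [t yt pt] : exists2 t : R,
    `|t| = nrm (star (peval p) * peval p) & spectrum (star (peval p) * peval p) t%:C.
  by apply: norm_in_spectrum; rewrite starM starK.
rewrite -peval_star -pevalM in pt.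
have [w aw] := spectrum_peval pt; rewrite hornerM.
rewrite horner_conj; last by rewrite (spectrum_real sa aw); exact: conjc_real.
move=> /(congr1 (@nrm R R[i])); rewrite nrmMc nrm_conj nrm_real yt nrm_starM -expr2 => /eqP.
by rewrite eqrXn2 ?nrm_ge0 // => /eqP <-; exact: pB.
Qed.

(** The graph of the calculus: one polynomial is close to [f] on the spectrum and, evaluated at [a],
    close to [y]. As a relation it satisfies the algebraic laws and uniqueness before any value is
    known to exist. *)
Definition cfc_rel f (y : A) := forall e : R, 0 < e -> exists2 p,
  (forall w, spectrum a w -> nrm (f w - p.[w]) <= e) & nrm (y - peval p) <= e.

Lemma cfc_rel_poly p : cfc_rel (horner p) (peval p).
Proof. by move=> e e0; exists p => *; rewrite subrr nrm0 ltW. Qed.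

Lemma cfc_rel_ext f g y : (forall w, spectrum a w -> f w = g w) ->
  cfc_rel f y -> cfc_rel g y.
Proof.
move=> fg fy e e0; have [p fp yp] := fy e e0; exists p => // w aw.
by rewrite -fg // fp.
Qed.

Lemma cfc_rel_norm_le f y (B : R) : cfc_rel f y ->
  (forall w, spectrum a w -> nrm (f w) <= B) -> nrm y <= B.
Proof.
move=> fy fB; apply/ler_addgt0Pr => e e0.
have [p fp yp] := fy _ (divr_gt0 e0 (ltr0Sn R 1)).
have : nrm (peval p) <= B + e / 2.
  apply: peval_norm_le => w aw.
  have := nrm_dist (f w) p.[w] 0; rewrite !subr0 nrm_distC.
  by have := fp w aw; have := fB w aw; lra.
by have := nrm_dist (peval p) y 0; rewrite !subr0; lra.
Qed.

Lemma cfc_relD f g y z : cfc_rel f y -> cfc_rel g z ->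
  cfc_rel (fun w => f w + g w) (y + z).
Proof.
move=> fy gz e e0; have e2 : 0 < e / 2 by lra.
have [p fp yp] := fy _ e2; have [q gq zq] := gz _ e2.
have D (V : normedZmodType R[i]) (b c b' c' : V) :
    nrm (b - b') <= e / 2 -> nrm (c - c') <= e / 2 -> nrm (b + c - (b' + c')) <= e.
  by move=> h1 h2; rewrite opprD addrACA (le_trans (nrmD _ _)) //; lra.
exists (p + q) => [w aw|]; first by rewrite hornerD; apply: D; auto.
by rewrite pevalD; apply: D.
Qed.

Lemma cfc_rel_star f y : cfc_rel f y -> cfc_rel (fun w => conjc (f w)) (star y).
Proof.
move=> fy e e0; have [p fp yp] := fy e e0.
exists (map_poly conjc p) => [w aw|]; last by rewrite peval_star -starB nrm_star.
rewrite horner_conj; last by rewrite (spectrum_real sa aw); exact: conjc_real.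
by rewrite -rmorphB nrm_conj; exact: fp.
Qed.

Lemma cfc_relM f g y z : cfc_rel f y -> cfc_rel g z ->
  cfc_rel (fun w => f w * g w) (y * z).
Proof.
move=> fy gz e e0.
(* No continuity of [h] is at hand; it is bounded on the spectrum because it is within 1 of a
   polynomial there, and the spectrum lies in a disk. *)
have bnd h u : cfc_rel h u -> exists2 B : R, 0 < B &
    nrm u <= B /\ forall w, spectrum a w -> nrm (h w) <= B.
  move=> hu; have [p hp _] := hu 1 ltr01.
  have [b pb] := poly_disk_bound p `|a|.
  exists (nrm u + (nrm b + 1)).
    by have := nrm_ge0 u; have := nrm_ge0 b; lra.
  split; first by have := nrm_ge0 b; lra.
  move=> w aw; have := nrm_dist p.[w] (h w) 0; rewrite !subr0.
  have : nrm p.[w] <= nrm b.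
    have wa : `|w| <= `|a| by rewrite !nrmE lecR spectrum_bound.
    have pbw := pb _ wa.
    have b0 : 0 <= b := le_trans (normr_ge0 _) pbw.
    by rewrite -lecR -!nrmE (ger0_norm b0).
  by have := hp w aw; have := nrm_ge0 u; lra.
have [B B0 [yB fB]] := bnd f y fy; have [C C0 [zC gC]] := bnd g z gz.
(* The three error terms of the product are at most [d * C], [B * d] and [d * d], and [d <= 1]
   absorbs the last into [d]. *)
pose d := Num.min 1 (e / (B + C + 1)).
have d0 : 0 < d by rewrite lt_min ltr01 divr_gt0 //; lra.
have d1 : d <= 1 by rewrite ge_min lexx.
have de : d * (B + C + 1) <= e.
  by rewrite -ler_pdivlMr ?ge_min ?lexx ?orbT //; lra.
have [p fp yp] := fy _ d0; have [q gq zq] := gz _ d0.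
exists (p * q) => [w aw|].
  rewrite hornerM.
  have -> : f w * g w - p.[w] * q.[w] =
      (f w - p.[w]) * g w + (f w * (g w - q.[w]) - (f w - p.[w]) * (g w - q.[w])) by ring.
  have := nrmD ((f w - p.[w]) * g w) (f w * (g w - q.[w]) - (f w - p.[w]) * (g w - q.[w])).
  have := nrmB (f w * (g w - q.[w])) ((f w - p.[w]) * (g w - q.[w])).
  rewrite !nrmMc; have := fp w aw; have := gq w aw; have := fB w aw; have := gC w aw.
  have := nrm_ge0 (f w); have := nrm_ge0 (g w).
  have := nrm_ge0 (f w - p.[w]); have := nrm_ge0 (g w - q.[w]); nra.
rewrite pevalM.
have -> : y * z - peval p * peval q =
      (y - peval p) * z + (y * (z - peval q) - (y - peval p) * (z - peval q)).
  rewrite -mulrBl.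
  have -> : y - (y - peval p) = peval p by rewrite opprB addrC subrK.
  by rewrite mulrBr mulrBl addrA subrK.
have := nrmD ((y - peval p) * z) (y * (z - peval q) - (y - peval p) * (z - peval q)).
have := nrmB (y * (z - peval q)) ((y - peval p) * (z - peval q)).
have := nrmM (y - peval p) z; have := nrmM y (z - peval q).
have := nrmM (y - peval p) (z - peval q).
have := nrm_ge0 y; have := nrm_ge0 z.
have := nrm_ge0 (y - peval p); have := nrm_ge0 (z - peval q); nra.
Qed.

Lemma cfc_rel_unique f y z : cfc_rel f y -> cfc_rel f z -> y = z.
Proof.
move=> fy fz; apply/eqP; rewrite -subr_eq0; apply/eqP.
apply: (@nrm_small _ _ _ 4) => e e0.
have [p fp yp] := fy e e0; have [q fq zq] := fz e e0.
have pq : nrm (peval p - peval q) <= 2 * e.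
  rewrite -pevalB; apply: peval_norm_le => w aw; rewrite hornerD hornerN.
  have := nrm_dist (f w) p.[w] q.[w]; rewrite nrm_distC (nrm_distC (f w)).
  by have := fp w aw; have := fq w aw; rewrite !(nrm_distC (f w)); lra.
have := nrm_dist (peval p) y z; have := nrm_dist (peval q) (peval p) z.
by rewrite (nrm_distC (peval q) z); lra.
Qed.

Lemma cfc_rel_exists f :
  (forall e : R, 0 < e -> exists p, forall w, spectrum a w -> nrm (f w - p.[w]) <= e) ->
  exists y, cfc_rel f y.
Proof.
move=> fp.
have h0 n : 0 < (2^-1 : R) ^+ n by rewrite exprn_gt0 // invr_gt0.
have [p pP] := choice (fun n => fp _ (h0 n)).
have h1 : 0 <= (2^-1 : R) < 1 by apply/andP; split; lra.
have [|y yP] := @nrm_complete _ A (fun n => peval (p n)).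
  move=> e e0; have [N HN] := expr_small h1 (divr_gt0 e0 (ltr0Sn R 1)).
  exists N => n Nn; rewrite -pevalB; apply: peval_norm_le => w aw.
  rewrite hornerD hornerN; have := nrm_dist (f w) (p n).[w] (p N).[w].
  have := HN n Nn; have := HN N (leqnn N); have := pP n w aw; have := pP N w aw.
  by rewrite (nrm_distC (p n).[w] (f w)); lra.
exists y => e e0; have [N HN] := expr_small h1 e0; have [N' HN'] := yP e e0.
exists (p (maxn N N')); last by apply: HN'; rewrite leq_maxr.
move=> w aw; apply: le_trans (pP _ _ aw) _; apply: HN; exact: leq_maxl.
Qed.

End PolynomialCalculus.

Section FunctionalCalculus.
Variables (R : realType) (A : cstarAlgType R).
Implicit Types (a : A) (f : R[i] -> R[i]).

Lemma continuous_on_spectrumP a f : continuous_on_spectrum a f <->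
  forall w, spectrum a w -> forall e : R, 0 < e -> exists2 d : R, 0 < d &
    forall w', spectrum a w' -> nrm (w - w') < d -> nrm (f w - f w') < e.
Proof.
rewrite /continuous_on_spectrum subspace_continuousP; split=> H w aw.
- move=> e e0; have /cvgrPdist_lt /(_ e%:C) := H w aw.
  rewrite ltcR => /(_ e0) /nbhs_normP[d /=]; rewrite ltcE /= => /andP[/eqP d1 d2] dP.
  exists (complex.Re d) => // w' aw' ww'; rewrite -nrm_lt; apply: dP => //=.
  have -> : d = (complex.Re d)%:C by apply/eqP; rewrite eq_complex /= d1 !eqxx.
  by rewrite nrm_lt.
- apply/cvgrPdist_lt => e; rewrite ltcE /= => /andP[/eqP e1 e2].
  have [d d0 dP] := H w aw _ e2.
  apply/(@nbhs_normP _ R[i]^o); exists d%:C; first by rewrite /= ltcR.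
  move=> w' /= ww' aw'.
  have -> : e = (complex.Re e)%:C by apply/eqP; rewrite eq_complex /= e1 !eqxx.
  by rewrite nrm_lt; apply: dP => //; rewrite -nrm_lt.
Qed.

Definition real_spectrum a : set R := [set t | spectrum a t%:C].

Lemma closed_real_spectrum a : closed (real_spectrum a).
Proof.
move=> t ta /= [r [r1 r2]].
have r0 : 0 < nrm r + 1 by have := nrm_ge0 r; lra.
have [|u [/= au tu]] := ta (ball t (nrm r + 1)^-1).
  by apply: nbhsx_ballx; rewrite invr_gt0.
apply: au; apply: (invertible_near r1 r2).
rewrite opprD addrACA opprK addNr addr0 -scalerBl -rmorphB /= nrmZr nrm1 mulr1.
have {}tu : `|t - u| < (nrm r + 1)^-1 := tu.
have : `|t - u| * (nrm r + 1) < 1 by rewrite -ltr_pdivlMr // div1r.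
by have := normr_ge0 (t - u); lra.
Qed.

Lemma compact_real_spectrum a : compact (real_spectrum a).
Proof.
have -> : real_spectrum a = real_spectrum a `&` `[- nrm a, nrm a].
  apply/seteqP; split=> [t at_|t []//]; split => //.
  by rewrite /= in_itv /= -ler_norml -nrm_real; exact: spectrum_bound.
by rewrite setIC; apply: compact_closedI; [exact: segment_compact|exact: closed_real_spectrum].
Qed.

(** Continuity is given only on the spectrum, which may have gaps. Compactness bounds [g] there,
    Tietze's theorem extends it to the line, and Weierstrass' theorem applies on the segment of
    radius [nrm a]. *)
Lemma continuous_on_spectrum_real_approx a (g : R[i] -> R) : star a = a ->
  (forall w, spectrum a w -> forall e : R, 0 < e -> exists2 d : R, 0 < d &
    forall w', spectrum a w' -> nrm (w - w') < d -> `|g w - g w'| < e) ->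
  forall e, 0 < e -> exists p : {poly R},
    forall t : R, spectrum a t%:C -> `|g t%:C - p.[t]| <= e.
Proof.
move=> sa cg e e0.
have cG : {within real_spectrum a, continuous (fun t : R => g t%:C)}.
  apply/subspace_continuousP => t at_; apply/cvgrPdist_lt => d d0.
  have [r r0 rP] := cg _ at_ d d0.
  apply/nbhs_normP; exists r => //= u tu au; apply: rP => //.
  by rewrite -rmorphB nrm_real.
have cnG : {within real_spectrum a, continuous (fun t : R => `|g t%:C|)}.
  move=> t; apply: continuous_comp; first exact: cG.
  exact: norm_continuous.
have [c _ cP] := compact_EVT_max (spectrum_nonempty sa) (compact_real_spectrum (a := a)) cnG.
have B0 : 0 < `|g c%:C| + 1 by have := normr_ge0 (g c%:C); lra.
have nR : normal_space R by exact: pseudometric_normal.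
have [|G [gG contG _]] := continuous_bounded_extension nR
  (closed_real_spectrum (a := a)) B0 cG.
  by move=> t at_; apply: le_trans (cP t _) _; [rewrite inE|lra].
have [k [p pE] pP] := weierstrass (nrm a) contG e0.
exists p => t at_; rewrite -pE; have -> : g t%:C = G t by apply: gG; rewrite inE.
by apply: pP; rewrite -nrm_real; exact: spectrum_bound.
Qed.

Lemma continuous_on_spectrum_approx a f : star a = a -> continuous_on_spectrum a f ->
  forall e : R, 0 < e -> exists p : {poly R[i]},
    forall w, spectrum a w -> nrm (f w - p.[w]) <= e.
Proof.
move=> sa /continuous_on_spectrumP cf e e0; have e2 : 0 < e / 2 by lra.
have [|p pP] := @continuous_on_spectrum_real_approx a (fun w => complex.Re (f w)) sa _ _ e2.
  move=> w aw d d0; have [r r0 rP] := cf w aw d d0; exists r => // w' aw' ww'.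
  by rewrite -raddfB /= (le_lt_trans (normr_Re_le _)) // rP.
have [|q qP] := @continuous_on_spectrum_real_approx a (fun w => complex.Im (f w)) sa _ _ e2.
  move=> w aw d d0; have [r r0 rP] := cf w aw d d0; exists r => // w' aw' ww'.
  by rewrite -raddfB /= (le_lt_trans (normr_Im_le _)) // rP.
exists (map_poly (real_complex R) p + 'i%C *: map_poly (real_complex R) q) => w aw.
have wE := spectrum_real sa aw; rewrite wE in aw *.
set t := complex.Re w in aw *.
rewrite hornerD hornerZ !horner_map /= [f _]complexE opprD addrACA -mulrBr -!rmorphB /=.
apply: le_trans (nrmD _ _) _; rewrite nrmMc nrmi mul1r !nrm_real.
by have := pP t aw; have := qP t aw; lra.
Qed.

Theorem functional_calculus_exists a : star a = a ->
  exists Phi, functional_calculus a Phi.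
Proof.
move=> sa.
have ex f : continuous_on_spectrum a f -> exists y, cfc_rel a f y.
  by move=> cf; apply: cfc_rel_exists => //; exact: continuous_on_spectrum_approx.
pose Phi f := xget 0 (cfc_rel a f).
have PhiP f y : cfc_rel a f y -> Phi f = y.
  by move=> fy; apply: (cfc_rel_unique sa (f := f)) => //; exact: (xgetI 0 fy).
have PhiC f : continuous_on_spectrum a f -> cfc_rel a f (Phi f).
  by move=> /ex[y fy]; rewrite (PhiP _ _ fy).
exists Phi; split.
- by move=> f g cf fg; apply/esym/PhiP; apply: cfc_rel_ext fg _; exact: PhiC.
- by move=> f g cf cg; apply: PhiP; apply: cfc_relD; exact: PhiC.
- by move=> f g cf cg; apply: PhiP; apply: cfc_relM; auto.
- by move=> f cf; apply: PhiP; apply: cfc_rel_star; auto.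
- move=> c; apply: PhiP; rewrite -(pevalC a); apply: cfc_rel_ext (cfc_rel_poly a _).
  by move=> w _; rewrite hornerC.
- apply: PhiP; rewrite -{2}(pevalX a); apply: cfc_rel_ext (cfc_rel_poly a _).
  by move=> w _; rewrite hornerX.
(* The bound [M] is complex; it dominates a norm at some point of the nonempty spectrum, hence is
   real and nonnegative. *)
- move=> f M cf fM; have [t at_] := spectrum_nonempty sa.
  have M0 : 0 <= M := le_trans (normr_ge0 _) (fM _ at_).
  have -> : M = (nrm M)%:C by rewrite -nrmE ger0_norm.
  rewrite nrm_le; apply: (cfc_rel_norm_le sa (PhiC _ cf)) => w aw.
  by rewrite -lecR -!nrmE (ger0_norm M0); exact: fM.
Qed.

Lemma cfcP a : star a = a -> functional_calculus a (cfc a).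
Proof.
move=> sa; have [Phi PhiP] := functional_calculus_exists sa.
exact: (xgetI _ PhiP).
Qed.

End FunctionalCalculus.

(** * Real functional calculus and positivity *)

Section PointwiseContinuity.
Variable R : realType.
Implicit Types f g : R -> R.

Lemma continuous_idR : continuous (id : R -> R).
Proof. by move=> x; exact: cvg_id. Qed.

Lemma continuous_cstR (c : R) : continuous (fun _ : R => c).
Proof. by move=> x; exact: cvg_cst. Qed.

Lemma continuous_fun_add f g : continuous f -> continuous g ->
  continuous (fun t => f t + g t).
Proof. by move=> cf cg x; apply: cvgD; [exact: cf|exact: cg]. Qed.

Lemma continuous_fun_sub f g : continuous f -> continuous g ->
  continuous (fun t => f t - g t).
Proof. by move=> cf cg x; apply: cvgB; [exact: cf|exact: cg]. Qed.

Lemma continuous_fun_opp f : continuous f -> continuous (fun t => - f t).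
Proof. by move=> cf x; apply: cvgN; exact: cf. Qed.

Lemma continuous_fun_mul f g : continuous f -> continuous g ->
  continuous (fun t => f t * g t).
Proof. by move=> cf cg x; apply: cvgM; [exact: cf|exact: cg]. Qed.

Lemma continuous_fun_scale (c : R) f : continuous f -> continuous (fun t => c * f t).
Proof. by apply: continuous_fun_mul => x; exact: cvg_cst. Qed.

Lemma continuous_fun_comp f g : continuous f -> continuous g ->
  continuous (fun t => g (f t)).
Proof. by move=> cf cg x; exact: (continuous_comp (cf x) (cg (f x))). Qed.

Lemma continuous_fun_norm f : continuous f -> continuous (fun t => `|f t|).
Proof. by move=> cf; apply: continuous_fun_comp => //; exact: norm_continuous. Qed.

Lemma continuous_fun_exp f n : continuous f -> continuous (fun t => f t ^+ n).
Proof.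
move=> cf; elim: n => [|n IH]; first by move=> x; exact: cvg_cst.
have -> : (fun t => f t ^+ n.+1) = fun t => f t * f t ^+ n.
  by apply/funext => t; rewrite exprS.
exact: continuous_fun_mul.
Qed.

Lemma continuous_fun_max f g : continuous f -> continuous g ->
  continuous (fun t => Num.max (f t) (g t)).
Proof.
move=> cf cg.
have -> : (fun t => Num.max (f t) (g t)) = fun t => 2^-1 * (f t + g t + `|f t - g t|).
  by apply/funext => t; exact: maxr_norm.
apply: continuous_fun_scale; apply: continuous_fun_add.
  exact: continuous_fun_add.
exact/continuous_fun_norm/continuous_fun_sub.
Qed.

End PointwiseContinuity.

Section RealCalculus.
Variables (R : realType) (A : cstarAlgType R).
Implicit Types (a b x y : A) (f g : R -> R).

Lemma continuous_on_spectrum_real a f : continuous f ->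
  continuous_on_spectrum a (fun z => (f (complex.Re z))%:C).
Proof.
move=> cf; apply/continuous_on_spectrumP => w aw e e0.
have /cvgrPdist_lt /(_ e e0) /nbhs_normP[d /= d0 dP] := cf (complex.Re w).
exists d => // w' _ ww'; rewrite -rmorphB nrm_real; apply: dP => /=.
by apply: le_lt_trans ww'; rewrite -raddfB; exact: normr_Re_le.
Qed.

Section Fixed.
Variable a : A.
Hypothesis sa : star a = a.

Let cP := cfcP sa.
Let cC f (cf : continuous f) := continuous_on_spectrum_real (a := a) cf.

Lemma real_spectrum_bound t : spectrum a t%:C -> `|t| <= nrm a.
Proof. by move=> /spectrum_bound; rewrite nrm_real. Qed.

Lemma cfcR_ext f g : continuous f ->
  (forall t, spectrum a t%:C -> f t = g t) -> cfcR f a = cfcR g a.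
Proof.
move=> cf fg; apply: (fcalc_ext cP); first exact: cC.
by move=> z az /=; rewrite fg // -(spectrum_real sa az).
Qed.

Lemma cfcRD f g : continuous f -> continuous g ->
  cfcR (fun t => f t + g t) a = cfcR f a + cfcR g a.
Proof.
move=> cf cg; rewrite /cfcR -(fcalcD cP (cC cf) (cC cg)); congr (cfc a _).
by apply/funext => z; rewrite rmorphD.
Qed.

Lemma cfcRM f g : continuous f -> continuous g ->
  cfcR (fun t => f t * g t) a = cfcR f a * cfcR g a.
Proof.
move=> cf cg; rewrite /cfcR -(fcalcM cP (cC cf) (cC cg)); congr (cfc a _).
by apply/funext => z; rewrite rmorphM.
Qed.

Lemma cfcR_cst (c : R) : cfcR (fun=> c) a = c%:C *: 1.
Proof. exact: (fcalc_cst cP). Qed.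

Lemma cfcR_id : cfcR id a = a.
Proof.
rewrite -[RHS](fcalc_id cP); apply: (fcalc_ext cP).
  exact: (cC (@continuous_idR R)).
by move=> z /(spectrum_real sa).
Qed.

Lemma cfcR_sa f : continuous f -> star (cfcR f a) = cfcR f a.
Proof.
move=> cf; rewrite -[LHS](fcalc_star cP (cC cf)); congr (cfc a _).
by apply/funext => z; exact: conjc_real.
Qed.

Lemma cfcRZ (c : R) f : continuous f ->
  cfcR (fun t => c * f t) a = c%:C *: cfcR f a.
Proof.
by move=> cf; rewrite (cfcRM (@cst_continuous _ _ c) cf) cfcR_cst mulr_algl.
Qed.

Lemma cfcRB f g : continuous f -> continuous g ->
  cfcR (fun t => f t - g t) a = cfcR f a - cfcR g a.
Proof.
move=> cf cg.
have -> : (fun t => f t - g t) = fun t => f t + -1 * g t.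
  by apply/funext => t; rewrite mulN1r.
rewrite cfcRD ?cfcRZ // ?rmorphN ?rmorph1 ?scaleN1r // .
exact: continuous_fun_scale.
Qed.

Lemma cfcRX f n : continuous f -> cfcR (fun t => f t ^+ n) a = cfcR f a ^+ n.
Proof.
move=> cf; elim: n => [|n IH]; first by rewrite cfcR_cst scale1r expr0.
have -> : (fun t => f t ^+ n.+1) = fun t => f t * f t ^+ n.
  by apply/funext => t; rewrite exprS.
by rewrite exprS -IH -cfcRM //; exact: continuous_fun_exp.
Qed.

Lemma cfcR_norm_le f (B : R) : continuous f ->
  (forall t, spectrum a t%:C -> `|f t| <= B) -> nrm (cfcR f a) <= B.
Proof.
move=> cf fB; rewrite -nrm_le; apply: (fcalc_norm_le cP (cC cf)) => z az.
by rewrite nrm_le nrm_real fB // -(spectrum_real sa az).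
Qed.

Lemma cfcR_poly f (p : {poly R}) : continuous f ->
  cfcR (fun t => p.[f t]) a = peval (cfcR f a) (map_poly (real_complex R) p).
Proof.
move=> cf; elim/poly_ind: p => [|p c IH].
  rewrite rmorph0 /peval rmorph0 -[RHS](scale0r 1) -(cfcR_cst 0).
  by congr cfcR; apply/funext => t; rewrite horner0.
rewrite rmorphD rmorphM /= map_polyX map_polyC pevalD pevalM pevalX pevalC -IH.
have cpf : continuous (fun t => p.[f t]).
  by move=> x; exact: (continuous_comp (cf x) (@continuous_horner _ p _)).
rewrite -cfcR_cst -cfcRM // -cfcRD //; last exact: cst_continuous.
  by congr cfcR; apply/funext => t; rewrite !hornerE.
exact: continuous_fun_mul.
Qed.

Lemma cfcR_near f g (e : R) : continuous f -> continuous g ->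
  (forall t, spectrum a t%:C -> `|f t - g t| <= e) ->
  nrm (cfcR f a - cfcR g a) <= e.
Proof.
move=> cf cg fg; rewrite -cfcRB //; apply: cfcR_norm_le => //.
exact: continuous_fun_sub.
Qed.

(** Polynomials in [a] commute with [x], and the commutator with [x] is continuous in norm. *)
Lemma cfcR_comm f x : continuous f -> a * x = x * a -> cfcR f a * x = x * cfcR f a.
Proof.
move=> cf ax; apply/eqP; rewrite -subr_eq0; apply/eqP.
apply: (@nrm_small _ _ _ (2 * nrm x)) => e e0.
have [k [[p pE] fp]] : exists g, polynomial_function g /\
    forall t, `|t| <= nrm a -> `|f t - g t| <= e.
  by have [g pg gP] := weierstrass (nrm a) cf e0; exists g.
have px := peval_comm (map_poly (real_complex R) p) ax.
have := cfcR_poly p (@continuous_idR R); rewrite cfcR_id => pa.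
have : nrm (cfcR f a - cfcR (fun t => p.[t]) a) <= e.
  apply: cfcR_near => // [x' |t at_]; first exact: continuous_horner.
  by rewrite -pE; apply: fp; exact: real_spectrum_bound.
rewrite pa; set q := peval _ _ in px pa *; set F := cfcR f a => Fq.
have -> : F * x - x * F = (F - q) * x - x * (F - q).
  by rewrite mulrBl mulrBr px opprB addrA subrK.
apply: le_trans (nrmB _ _) _.
have := nrmM (F - q) x; have := nrmM x (F - q); have := nrm_ge0 x; nra.
Qed.

End Fixed.

(** The law is clear for polynomial [g]. The general [g] is approximated on a segment of radius [M]
    large enough for both the spectrum of [f(a)] and the values of [f], so the two sets need not be
    compared. *)
Lemma cfcR_comp a f g : star a = a -> continuous f -> continuous g ->
  cfcR g (cfcR f a) = cfcR (fun t => g (f t)) a.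
Proof.
move=> sa cf cg; set b := cfcR f a; have sb : star b = b by exact: cfcR_sa.
have cgf := continuous_fun_comp cf cg.
have [B _ fB] := bounded_segment (nrm a) cf; pose M := Num.max B (nrm b).
apply/eqP; rewrite -subr_eq0; apply/eqP; apply: (@nrm_small _ _ _ 2) => e e0.
have [k [p pE] gp] := weierstrass M cg e0.
have cp : continuous (fun t => p.[t]) by move=> t; exact: continuous_horner.
have := cfcR_poly sb p (@continuous_idR R); rewrite (cfcR_id sb) -(cfcR_poly sa p cf) => bp.
have h1 : nrm (cfcR g b - cfcR (fun t => p.[t]) b) <= e.
  apply: (cfcR_near sb) => // t bt; rewrite -pE; apply: gp.
  by rewrite le_max (real_spectrum_bound bt) orbT.
have h2 : nrm (cfcR (fun t => g (f t)) a - cfcR (fun t => p.[f t]) a) <= e.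
  apply: (cfcR_near sa) => //; first exact: (continuous_fun_comp cf cp).
  move=> t at_; rewrite -pE; apply: gp; rewrite le_max fB //.
  exact: real_spectrum_bound.
have := nrm_dist (cfcR (fun t => p.[t]) b) (cfcR g b) (cfcR (fun t => g (f t)) a).
by rewrite nrm_distC -bp in h2; lra.
Qed.

(** * Positive elements *)

Definition positive x := star x = x /\ forall t : R, spectrum x t%:C -> 0 <= t.

Lemma spectrum_scalar_sub x (t s : R) :
  spectrum x s%:C -> spectrum (t%:C *: 1 - x) (t - s)%:C.
Proof.
move=> xs H; apply: xs.
have -> : s%:C *: 1 - x = - ((t - s)%:C *: 1 - (t%:C *: 1 - x)).
  by rewrite rmorphB scalerBl !opprB [RHS]addrC addrA subrK.
by rewrite -scaleN1r; apply: invertibleZ => //; rewrite oppr_eq0 oner_eq0.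
Qed.

(** The spectrum of a sum is not governed by those of the summands, whereas this norm criterion adds
    up by the triangle inequality. From left to right [t = |x|] works; conversely [t - s] is in the
    spectrum of [t - x], so [|t - s| <= t]. *)
Lemma positive_nrmP x : positive x <->
  star x = x /\ exists2 t : R, 0 <= t & nrm (t%:C *: 1 - x) <= t.
Proof.
split=> -[sx xP]; split=> //.
  exists (nrm x); first exact: nrm_ge0.
  rewrite -{2}(cfcR_id sx) -(cfcR_cst sx); apply: (cfcR_near sx).
  - exact: continuous_cstR.
  - exact: continuous_idR.
  - move=> t xt; have := real_spectrum_bound xt; rewrite !ler_norml => /andP[? ?].
    by have := xP t xt; move=> ?; apply/andP; split; lra.
have [t t0 xt] := xP; move=> s xs.
have := spectrum_scalar_sub (t := t) xs.
move=> /real_spectrum_bound H; have := le_trans H xt.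
by rewrite ler_norml => /andP[]; lra.
Qed.

Lemma positiveD x y : positive x -> positive y -> positive (x + y).
Proof.
move=> /positive_nrmP[sx [t t0 xt]] /positive_nrmP[sy [s s0 ys]].
apply/positive_nrmP; split; first by rewrite starD sx sy.
exists (t + s); first by rewrite addr_ge0.
rewrite rmorphD scalerDl opprD addrACA (le_trans (nrmD _ _)) // lerD //.
Qed.

(** Spectral mapping for continuous functions is bypassed: with [B] bounding [|f|], the values of
    [B - f] on the spectrum lie between 0 and [B], which is the norm criterion. *)
Lemma cfcR_positive a f : star a = a -> continuous f ->
  (forall t, spectrum a t%:C -> 0 <= f t) -> positive (cfcR f a).
Proof.
move=> sa cf f0; apply/positive_nrmP; split; first exact: cfcR_sa.
have [B B0 fB] := bounded_segment (nrm a) cf.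
exists B; first exact: ltW.
rewrite -(cfcR_cst sa); apply: (cfcR_near sa) => //; first exact: continuous_cstR.
move=> t at_; have := f0 t at_.
have := fB t (real_spectrum_bound at_); rewrite !ler_norml => /andP[? ?] ?.
by apply/andP; split; lra.
Qed.

Lemma positiveZ (c : R) x : 0 <= c -> positive x -> positive (c%:C *: x).
Proof.
move=> c0 [sx x0]; rewrite -{1}(cfcR_id sx) -(cfcRZ sx) //; last exact: continuous_idR.
apply: (cfcR_positive sx); first exact/continuous_fun_scale/continuous_idR.
by move=> t /x0 t0; rewrite mulr_ge0.
Qed.

Lemma positive_sq x : star x = x -> positive (x ^+ 2).
Proof.
move=> sx; rewrite -{1}(cfcR_id sx) -(cfcRX sx) //; last exact: continuous_idR.
apply: (cfcR_positive sx); first exact/continuous_fun_exp/continuous_idR.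
by move=> t _; rewrite sqr_ge0.
Qed.

(** The square roots of [x] and [y] commute as well, so [x * y] is the square of their self-adjoint
    product. *)
Lemma positiveM x y : x * y = y * x -> positive x -> positive y -> positive (x * y).
Proof.
move=> xy [sx x0] [sy y0]; pose r := cfcR Num.sqrt x; pose s := cfcR Num.sqrt y.
have cs := @sqrt_continuous R.
have sq (z : A) : star z = z -> (forall t : R, spectrum z t%:C -> 0 <= t) ->
    cfcR Num.sqrt z * cfcR Num.sqrt z = z :> A.
  move=> sz z0; rewrite -(cfcRM sz) // -[RHS](cfcR_id sz); apply: (cfcR_ext sz).
    exact: continuous_fun_mul.
  by move=> t /z0 t0; rewrite -expr2 sqr_sqrtr.
have ry : r * y = y * r by exact: cfcR_comm.
have rs : s * r = r * s by apply: cfcR_comm.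
rewrite -(sq x sx x0) -(sq y sy y0) -/r -/s.
have -> : r * r * (s * s) = (r * s) ^+ 2 by rewrite expr2 -!mulrA (mulrA s) rs !mulrA.
by apply: positive_sq; rewrite starM !cfcR_sa.
Qed.

Lemma positive_nrm_le x (m : R) :
  positive x -> positive (m%:C *: 1 - x) -> nrm x <= m.
Proof.
move=> [sx x0] [_ xm]; have [t <- xt] := norm_in_spectrum sx.
rewrite ger0_norm ?x0 // -subr_ge0; apply: xm.
exact: spectrum_scalar_sub.
Qed.

Lemma spectrum_ge1 x t : positive (x - 1) -> spectrum x t%:C -> 1 <= t.
Proof.
move=> [_ x1] xt; rewrite -subr_ge0; apply: x1 => H; apply: xt.
have -> // : t%:C *: 1 - x = (t - 1)%:C *: 1 - (x - 1).
by rewrite rmorphB scalerBl scale1r opprB addrA subrK.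
Qed.

Lemma positive_ge1 x : positive (x - 1) -> star x = x /\ positive x.
Proof.
move=> x1; have sx : star x = x.
  by case: x1 => + _; rewrite starB star1 => /addIr.
by split=> //; split=> // t /(spectrum_ge1 x1); apply: le_trans.
Qed.

(* The second factor is invertible with positive inverse. *)
Lemma positive_mul_cancel x y : x * y = y * x -> positive (y - 1) ->
  positive (x * y) -> positive x.
Proof.
move=> xy y1 xyp; have [sy yp] := positive_ge1 y1.
(* Continuous on the whole line and equal to [t^-1] on the spectrum of [y], which lies above 1. *)
pose f (t : R) := (Num.max t 1)^-1.
have f1 t : 0 < Num.max t 1 :> R by rewrite lt_max ltr01 orbT.
have cf : continuous f.
  move=> t; apply: cvgV; first by rewrite gt_eqF.
  by apply: continuous_fun_max; [exact: continuous_idR|exact: continuous_cstR].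
have fp : positive (cfcR f y).
  by apply: (cfcR_positive sy) => // t _; rewrite invr_ge0 ltW.
have yf : y * cfcR f y = 1.
  rewrite -{1}(cfcR_id sy) -(cfcRM sy) //; last exact: continuous_idR.
  rewrite -[RHS]scale1r -(cfcR_cst sy 1); apply: (cfcR_ext sy).
    exact/continuous_fun_mul/cf/continuous_idR.
  move=> t /(spectrum_ge1 y1) t1; rewrite /f max_l // divff // gt_eqF //.
  exact: lt_le_trans t1.
have -> : x = x * y * cfcR f y by rewrite -mulrA yf mulr1.
apply: positiveM => //; apply/esym/cfcR_comm => //.
by rewrite mulrA xy.
Qed.

Lemma positive_exp_sub1 x n : positive (x - 1) -> positive (x ^+ n - 1).
Proof.
move=> x1; have [sx _] := positive_ge1 x1.
rewrite -{1}(cfcR_id sx) -(cfcRX sx) //; last exact: continuous_idR.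
rewrite -[X in _ - X]scale1r -(cfcR_cst sx 1) -(cfcRB sx).
- apply: (cfcR_positive sx).
    apply: continuous_fun_sub; last exact: continuous_cstR.
    exact/continuous_fun_exp/continuous_idR.
  by move=> t /(spectrum_ge1 x1) t1; rewrite subr_ge0 exprn_ege1.
- exact/continuous_fun_exp/continuous_idR.
- exact: continuous_cstR.
Qed.

(** Each step factors [v^2 - u^2 = (v + u) (v - u)] and cancels [v + u], which is at least 1. The
    order of the powers thus descends to the elements themselves. *)
Lemma positive_exp_cancel x y k : x * y = y * x ->
  positive (x - 1) -> positive (y - 1) ->
  positive (y ^+ (2 ^ k) - x ^+ (2 ^ k)) -> positive (y - x).
Proof.
move=> xy x1 y1; elim: k => [|k IH]; first by rewrite expn0 !expr1.
set u := x ^+ (2 ^ k) in IH *; set v := y ^+ (2 ^ k) in IH *.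
have uv : v * u = u * v by apply/esym/commrX/commr_sym/commrX.
rewrite expnSr !exprM -/u -/v; have [_ <-] := mulr_sub_add_comm uv => uvp.
have [_ u1] := positive_ge1 (positive_exp_sub1 (2 ^ k) x1).
have v1 := positive_exp_sub1 (2 ^ k) y1.
apply: IH; apply: (@positive_mul_cancel _ (v + u)).
- by have [-> ->] := mulr_sub_add_comm uv.
- by rewrite addrAC; apply: positiveD.
- by have [-> <-] := mulr_sub_add_comm uv.
Qed.

End RealCalculus.

(** * Joins in isocones *)

Section IteratedRoot.
Variable R : realType.

(** The root of order [2 ^ k] on nonnegative reals. For positive [k] it vanishes on negative reals,
    so it is continuous and isotone on the whole line. *)
Definition iter_sqrt k (t : R) : R := iter k Num.sqrt t.

Lemma iter_sqrt_continuous k : continuous (iter_sqrt k).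
Proof.
elim: k => [|k IH]; first exact: continuous_idR.
exact: (continuous_fun_comp IH (@sqrt_continuous R)).
Qed.

Lemma iter_sqrt_homo k : {homo iter_sqrt k : x y / x <= y}.
Proof. by elim: k => [//|k IH] x y xy; apply: ler_wsqrtr; exact: IH. Qed.

Lemma iter_sqrtK k t : 0 <= t -> iter_sqrt k t ^+ (2 ^ k) = t.
Proof.
move=> t0; elim: k => [|k IH]; first by rewrite expn0 expr1.
rewrite expnS exprM sqr_sqrtr //.
by case: k {IH} => //= k; exact: sqrtr_ge0.
Qed.

Lemma iter_sqrt_ge1 k t : 1 <= t -> 1 <= iter_sqrt k t.
Proof.
move=> t1; elim: k => //= k IH.
by rewrite -(sqrtr1 R); apply: ler_wsqrtr.
Qed.

Lemma bernoulli_inequality (y : R) n : 0 <= y -> 1 + n%:R * y <= (1 + y) ^+ n.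
Proof.
move=> y0; elim: n => [|n IH]; first by rewrite mul0r addr0 expr0.
rewrite exprS -natr1.
have y1 : 0 <= 1 + y by lra.
have := ler_wpM2l y1 IH; have : 0 <= n%:R * y * y by rewrite !mulr_ge0.
by lra.
Qed.

(** For [n = 2 ^ k.+1], Bernoulli's inequality [1 + n (2^(1/n) - 1) <= 2] bounds the difference by
    [1 / n], and [n >= k.+1 > 1 / e]. *)
Lemma iter_sqrt2_small (e : R) : 0 < e -> exists k, iter_sqrt k.+1 2 - 1 <= e.
Proof.
move=> e0; pose k := Num.truncn (1 / e); exists k.
have /andP[_] := Num.Theory.truncn_itv (divr_ge0 ler01 (ltW e0)).
rewrite ltr_pdivrMr // => ke.
have r1 := @iter_sqrt_ge1 k.+1 2 (ler1n _ 2).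
have r0 : 0 <= iter_sqrt k.+1 2 - 1 by lra.
have {}ke : 1 < k.+1%:R * e by [].
have := bernoulli_inequality (2 ^ k.+1) r0.
have -> : 1 + (iter_sqrt k.+1 2 - 1) = iter_sqrt k.+1 2 :> R by lra.
rewrite iter_sqrtK //.
have : (k.+1%:R : R) <= (2 ^ k.+1)%:R by rewrite ler_nat ltnW // ltn_expl.
have : 0 < k.+1%:R :> R by [].
move: (k.+1%:R : R) ((2 ^ k.+1)%:R : R) (iter_sqrt k.+1 2) r0 ke => n m r r0 ke n0 nm mr.
have : n * (r - 1) <= 1 by nra.
nra.
Qed.

End IteratedRoot.

Section Joins.
Variables (R : realType) (A : cstarAlgType R).
Implicit Types (b x y u v : A) (I : set A).

Lemma two_inv : (2^-1 : R[i]) = (2^-1 : R)%:C.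
Proof. by rewrite fmorphV rmorph_nat. Qed.

Lemma half_double x : (2^-1 : R[i]) *: (x + x) = x.
Proof.
have -> : x + x = (2 : R[i]) *: x by rewrite scaler_nat mulr2n.
by rewrite scalerA mulVf ?scale1r // pnatr_eq0.
Qed.

Lemma cabs_sa x : star x = x -> star (cabs x) = cabs x.
Proof. by move=> sx; exact: (cfcR_sa sx (@norm_continuous _ R)). Qed.

Lemma cabs_sqr x : star x = x -> cabs x ^+ 2 = x ^+ 2.
Proof.
move=> sx; have cn := @norm_continuous _ R.
rewrite -[in RHS](cfcR_id sx) /cabs -(cfcRX sx 2 cn) -(cfcRX sx 2 (@continuous_idR R)).
by congr cfcR; apply/funext => t; rewrite real_normK ?num_real.
Qed.

Lemma cabs_positive x : star x = x -> positive (cabs x).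
Proof. by move=> sx; apply: cfcR_positive => //; exact: norm_continuous. Qed.

Lemma cabsN x : star x = x -> cabs (- x) = cabs x.
Proof.
move=> sx; have cN : continuous (fun t : R => - t).
  exact/continuous_fun_opp/continuous_idR.
have -> : - x = cfcR (fun t => - t) x.
  have -> : (fun t : R => - t) = fun t => -1 * id t by apply/funext => t; rewrite mulN1r.
  by rewrite cfcRZ ?cfcR_id // ?rmorphN ?rmorph1 ?scaleN1r //; exact: continuous_idR.
rewrite /cabs cfcR_comp //; last exact: norm_continuous.
by congr cfcR; apply/funext => t; rewrite normrN.
Qed.

Lemma cabs_comm x y : star x = x -> x * y = y * x -> cabs x * y = y * cabs x.
Proof. by move=> sx; apply: (cfcR_comm sx); exact: norm_continuous. Qed.

Lemma cmeetE x y : star x = x -> star y = y -> cmeet x y = - cjoin (- x) (- y).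
Proof.
move=> sx sy; rewrite /cmeet /cjoin -scalerN; congr (_ *: _).
have -> : - x - - y = - (x - y) by rewrite opprD.
by rewrite cabsN ?starB ?sx ?sy // !opprD !opprK.
Qed.

(** Squaring both members of a commuting pair turns its sum [s] and product [p] into [s^2 - 2 p] and
    [p^2], so two pairs that agree in both continue to do so. *)
Lemma power_sum_eq x y u v k : x * y = y * x -> u * v = v * u ->
  x + y = u + v -> x * y = u * v ->
  x ^+ (2 ^ k) + y ^+ (2 ^ k) = u ^+ (2 ^ k) + v ^+ (2 ^ k).
Proof.
elim: k x y u v => [|k IH] x y u v xy uv sE pE; first by rewrite !expr1.
have sq (z w : A) : z * w = w * z -> z ^+ 2 + w ^+ 2 = (z + w) ^+ 2 - (z * w) *+ 2.
  move=> zw; rewrite !expr2 mulrDl !mulrDr -zw [z * w + w * w]addrC addrACA.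
  by rewrite -mulr2n addrK.
have pr (z w : A) : z * w = w * z -> z ^+ 2 * w ^+ 2 = (z * w) ^+ 2.
  by move=> zw; rewrite !expr2 -!mulrA; congr (_ * _); rewrite [RHS]mulrA -zw mulrA.
rewrite expnS !exprM; apply: IH.
- exact/commrX/commr_sym/commrX/commr_sym.
- exact/commrX/commr_sym/commrX/commr_sym.
- by rewrite !sq // sE pE.
- by rewrite !pr // pE.
Qed.

(* [b^n + b'^n = c^n + d^n] lies between [c^n] and [2 c^n], where [c] and [d]
   are the join and the meet. *)
Lemma cjoin_root_near b b' k : b * b' = b' * b ->
  positive (b - 1) -> positive (b' - 1) ->
  nrm (cjoin b b' - cfcR (iter_sqrt k.+1) (b ^+ (2 ^ k.+1) + b' ^+ (2 ^ k.+1)))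
    <= (iter_sqrt k.+1 2 - 1) * nrm (cjoin b b').
Proof.
move=> bb' b1 b1'; have [sb pb] := positive_ge1 b1; have [sb' pb'] := positive_ge1 b1'.
set n := (2 ^ k.+1)%N; set r := iter_sqrt k.+1.
have cr : continuous r := @iter_sqrt_continuous R k.+1.
pose w := cabs (b - b'); pose c := cjoin b b'; pose d := cmeet b b'; pose s := b + b'.
have sbb' : star (b - b') = b - b' by rewrite starB sb sb'.
have ss : star s = s by rewrite starD sb sb'.
have bbs : (b - b') * s = s * (b - b') by have [-> ->] := mulr_sub_add_comm bb'.
have ws : w * s = s * w by exact: cabs_comm.
have sw : star w = w by exact: cabs_sa.
have pw : positive w by exact: cabs_positive.
have cE : c = 2^-1%:C *: (s + w) by rewrite -two_inv.
have dE : d = 2^-1%:C *: (s - w) by rewrite -two_inv.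
have sc : star c = c by rewrite cE starZr starD ss sw.
have sd : star d = d by rewrite dE starZr starB ss sw.
have [sw1 sw2] := mulr_sub_add_comm (esym ws).
have cd : c * d = d * c.
  by rewrite cE dE -!scalerAl -!scalerAr sw1 sw2.
have cdD : c + d = b + b'.
  by rewrite cE dE -scalerDr addrACA subrr addr0 -two_inv half_double.
(* The product is [(s^2 - w^2) / 4], and [w^2 = (b - b')^2]. *)
have cdM : c * d = b * b'.
  rewrite cE dE -scalerAl -scalerAr scalerA sw2 cabs_sqr // !expr2 /s.
  have -> : (b + b') * (b + b') - (b - b') * (b - b') = (4 : R[i]) *: (b * b').
    by rewrite sqr_add_sub_comm // scaler_nat.
  by rewrite scalerA -two_inv -invfM -natrM mulVf ?scale1r // pnatr_eq0.
have c1 : positive (c - 1).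
  have -> : c - 1 = 2^-1%:C *: ((b - 1) + (b' - 1) + w).
    have -> : b - 1 + (b' - 1) + w = (s + w) - (1 + 1) by rewrite addrACA -opprD [LHS]addrAC.
    by rewrite scalerBr -cE -two_inv half_double.
  by apply: positiveZ; [rewrite invr_ge0|apply: positiveD => //; exact: positiveD].
have [_ pc] := positive_ge1 c1.
pose X := b ^+ n + b' ^+ n; have XE : X = c ^+ n + d ^+ n.
  exact/esym/power_sum_eq.
(* Positivity of [d] itself is not established: the exponent [2 ^ k.+1] is even, so [d ^+ n] is a
   square. The induction for [dcn] starts at exponent 2 for the same reason, from [c - d = w] and
   [c + d = s]. *)
have pdn : positive (d ^+ n).
  by rewrite /n expnSr exprM; apply: positive_sq; rewrite starX sd.
have dcn : positive (c ^+ n - d ^+ n).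
  have cw : c * w = w * c by rewrite cE -scalerAl -scalerAr mulrDl mulrDr ws.
  rewrite /n; elim: {n X XE pdn r cr} k => [|k IH].
    rewrite expn1; have [<- _] := mulr_sub_add_comm cd.
    have -> : c - d = w.
      by rewrite cE dE -scalerBr opprB [w - s]addrC addrACA subrr add0r -two_inv half_double.
    by rewrite cdD -/s; apply: positiveM => //; exact: positiveD.
  rewrite expnSr !exprM.
  set U := c ^+ _ in IH *; set V := d ^+ _ in IH *.
  have UV : U * V = V * U by exact/commrX/commr_sym/commrX/commr_sym.
  have [UV1 UV2] := mulr_sub_add_comm UV; rewrite -UV1.
  apply: positiveM => //; first by rewrite UV1 UV2.
  by apply: positiveD; rewrite /U /V expnSr exprM; apply: positive_sq; rewrite starX ?sc ?sd.
have X1 : positive (X - 1).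
  by rewrite XE addrAC; apply: positiveD => //; exact: positive_exp_sub1.
have [sX pX] := positive_ge1 X1.
pose G := cfcR r X; have sG : star G = G by exact: cfcR_sa.
have G1 : positive (G - 1).
  rewrite -[X in _ - X]scale1r -(cfcR_cst sX 1) -(cfcRB sX) //; last exact: continuous_cstR.
  apply: (cfcR_positive sX); first by apply: continuous_fun_sub => //; exact: continuous_cstR.
  by move=> t /(spectrum_ge1 X1) t1; rewrite subr_ge0 iter_sqrt_ge1.
have Gn : G ^+ n = X.
  rewrite -(cfcRX sX) // -[RHS](cfcR_id sX); apply: (cfcR_ext sX).
    exact: continuous_fun_exp.
  by move=> t /(spectrum_ge1 X1) t1; rewrite iter_sqrtK //; lra.
have Gc : G * c = c * G.
  apply: (cfcR_comm sX) => //; rewrite XE mulrDl mulrDr; congr (_ + _).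
    by rewrite -exprSr -exprS.
  exact/commr_sym/commrX.
pose K := r 2; have K1 : 1 <= K by apply: iter_sqrt_ge1; rewrite ler1n.
have cG : positive (G - c).
  apply: (@positive_exp_cancel _ _ _ _ k.+1 (esym Gc)) => //.
  by rewrite -/n Gn XE addrAC subrr add0r.
(* As [K ^+ n = 2], the comparison of powers reads [2 c^n - X = c^n - d^n]. *)
have Gc' : positive (K%:C *: c - G).
  apply: (@positive_exp_cancel _ _ _ _ k.+1) => //.
  - by rewrite -scalerAl -scalerAr Gc.
  - have -> : K%:C *: c - 1 = K%:C *: (c - 1) + (K - 1)%:C *: 1.
      by rewrite scalerBr rmorphB scalerBl scale1r addrA subrK.
    apply: positiveD; first by apply: positiveZ => //; lra.
    apply: positiveZ; first by lra.
    by rewrite -(expr1n A 2); apply: positive_sq; exact: star1.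
  - rewrite exprZn -rmorphXn -/n Gn iter_sqrtK // XE.
    have -> : (2 : R)%:C *: c ^+ n = c ^+ n + c ^+ n by rewrite rmorph_nat scaler_nat mulr2n.
    by rewrite opprD addrACA subrr add0r.
(* The chain [0 <= G - c <= (K - 1) c <= (K - 1) |c|] gives the norm bound. *)
rewrite nrm_distC -/c -/X -/G -/K; apply: positive_nrm_le => //.
have -> : ((K - 1) * nrm c)%:C *: 1 - (G - c) =
    (K - 1)%:C *: ((nrm c)%:C *: 1 - c) + (K%:C *: c - G).
  have -> : K%:C *: c = (K - 1)%:C *: c + c by rewrite rmorphB scalerBl scale1r subrK.
  by rewrite scalerBr scalerA -rmorphM opprB -[in RHS](addrA (_ *: c)) [RHS]addrA subrK.
apply: positiveD => //; apply: positiveZ; first by lra.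
rewrite -{2}(cfcR_id sc) -(cfcR_cst sc) -(cfcRB sc).
- apply: (cfcR_positive sc).
    by apply: continuous_fun_sub; [exact: continuous_cstR|exact: continuous_idR].
  move=> t /real_spectrum_bound; rewrite ler_norml subr_ge0 => /andP[_]; exact.
- exact: continuous_cstR.
- exact: continuous_idR.
Qed.

(** Closedness in terms of distances, a form that passes to [- I] by a change of sign. *)
Definition nrm_closed I := forall x,
  (forall e : R, 0 < e -> exists2 y, I y & nrm (x - y) <= e) -> I x.

Lemma cjoin_closed I : I `<=` selfadjoint -> nrm_closed I ->
  (forall x : R, I (x%:C *: 1)) -> (forall x y, I x -> I y -> I (x + y)) ->
  (forall f, isotone_continuous f -> forall x, I x -> I (cfcR f x)) ->
  forall b b', I b -> I b' -> b * b' = b' * b -> I (cjoin b b').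
Proof.
move=> Isa Icl Icst Iadd Iiso b b' Ib Ib' bb'.
have [sb sb'] := (Isa b Ib : star b = b, Isa b' Ib' : star b' = b').
(* The spectra of [b] and [b'] lie above [- (nrm b + nrm b')], so adding [t] moves both above 1. The
   join commutes with this shift because [b - b'] is unchanged. *)
pose t := nrm b + nrm b' + 1.
have shift x : star x = x -> nrm x <= nrm b + nrm b' -> positive (x + t%:C *: 1 - 1).
  move=> sx xt.
  have -> : x + t%:C *: 1 - 1 = cfcR (fun s => s + (t - 1)) x.
    rewrite (cfcRD sx (@continuous_idR R) (@continuous_cstR R (t - 1))).
    rewrite (cfcR_cst sx) (cfcR_id sx).
    by rewrite rmorphB scalerBl scale1r addrA.
  apply: (cfcR_positive sx).
    exact: (continuous_fun_add (@continuous_idR R) (@continuous_cstR R (t - 1))).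
  move=> s /real_spectrum_bound; rewrite ler_norml => /andP[? ?]; rewrite /t; lra.
have n0 := nrm_ge0 b; have n0' := nrm_ge0 b'.
have p1 : positive (b + t%:C *: 1 - 1) by apply: shift => //; lra.
have p1' : positive (b' + t%:C *: 1 - 1) by apply: shift => //; lra.
set u := b + t%:C *: 1 in p1; set u' := b' + t%:C *: 1 in p1'.
have Iu : I u by exact: Iadd.
have Iu' : I u' by exact: Iadd.
have uu' : u * u' = u' * u.
  rewrite /u /u' !mulrDl !mulrDr !mulr_algl !mulr_algr bb' !scalerA.
  by rewrite addrACA.
have uE : cjoin u u' = cjoin b b' + t%:C *: 1.
  rewrite /cjoin; have -> : u - u' = b - b' by rewrite /u /u' opprD addrACA subrr addr0.
  have -> : u + u' = (b + b') + (t%:C *: 1 + t%:C *: 1) by rewrite addrACA.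
  by rewrite addrAC scalerDr half_double.
have Iexp x n : I x -> positive (x - 1) -> I (x ^+ n).
  move=> Ix x1; have [sx [_ x0]] := positive_ge1 x1.
  (* An even power is not isotone on the line; truncating at 0 makes it so without changing it on
     the spectrum of [x]. *)
  pose f (s : R) := Num.max s 0 ^+ n.
  have cf : continuous f.
    apply/continuous_fun_exp/continuous_fun_max; first exact: continuous_idR.
    exact: continuous_cstR.
  have -> : x ^+ n = cfcR f x.
    rewrite -{1}(cfcR_id sx) -(cfcRX sx); last exact: continuous_idR.
    apply/esym/(cfcR_ext sx) => // s /x0 s0; by rewrite /f max_l.
  apply: Iiso => //; split=> // s s' ss'; apply: lerXn2r; rewrite ?nnegrE.
  - by rewrite le_max lexx orbT.
  - by rewrite le_max lexx orbT.
  - by rewrite ge_max !le_max ss' lexx orbT.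
have Iuu' : I (cjoin u u').
  apply: Icl => e e0.
  have N0 : 0 < nrm (cjoin u u') + 1 by have := nrm_ge0 (cjoin u u'); lra.
  have [k kP] := iter_sqrt2_small (divr_gt0 e0 N0).
  exists (cfcR (iter_sqrt k.+1) (u ^+ (2 ^ k.+1) + u' ^+ (2 ^ k.+1))).
    apply: Iiso; last by apply: Iadd; exact: Iexp.
    by split; [exact: iter_sqrt_continuous|exact: iter_sqrt_homo].
  apply: le_trans (cjoin_root_near k uu' p1 p1') _.
  have := iter_sqrt_ge1 k.+1 (ler1n R 2); move: kP; rewrite ler_pdivlMr //.
  by have := nrm_ge0 (cjoin u u'); nra.
have -> : cjoin b b' = cjoin u u' + (- t)%:C *: 1 by rewrite uE rmorphN scaleNr addrK.
exact: Iadd.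
Qed.

(** * The two implications *)

Lemma ultraweak_weak I : ultraweak_isocone I -> weak_isocone I.
Proof.
move=> [Isa Icst Iadd Iiso Icl Idense].
have Incl : nrm_closed I by move=> x; exact: closed_nrm.
have iso f x : isotone_continuous f -> I x -> I (cfcR f x).
  by move=> fi Ix; apply: (Iiso f fi); exists x.
have sa x : I x -> star x = x := @Isa x.
split=> //.
- move=> l b l0 Ib; have sb := sa b Ib.
  have -> : l%:C *: b = cfcR (fun t => l * t) b.
    by rewrite (cfcRZ sb) ?(cfcR_id sb) //; exact: continuous_idR.
  apply: iso => //; split; first exact/continuous_fun_scale/continuous_idR.
  by move=> x y xy; rewrite ler_wpM2l.
- move=> b b' Ib Ib' bb'; split.
    exact: (cjoin_closed Isa Incl Icst Iadd (fun f fi x => iso f x fi)).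
  rewrite cmeetE ?sa //.
  pose J : set A := [set x | I (- x)].
  have : J (cjoin (- b) (- b')).
    apply: (@cjoin_closed J); rewrite /J /= ?opprK //.
    + by move=> x /= /sa; rewrite starN => /oppr_inj.
    + move=> x xP; apply: Incl => e e0; have [y yJ xy] := xP e e0.
      by exists (- y) => //; rewrite -opprD nrmN.
    + by move=> x; rewrite -scaleNr -rmorphN; exact: Icst.
    + by move=> x y Jx Jy; rewrite opprD; exact: Iadd.
    + move=> f [cf hf] x Jx; have sx : star x = x.
        by have := sa _ Jx; rewrite starN => /oppr_inj.
      have cN : continuous (fun t : R => - t) by exact/continuous_fun_opp/continuous_idR.
      have snx : star (- x) = - x by rewrite starN sx.
      have cg := continuous_fun_opp (continuous_fun_comp cN cf).
      (* Conjugating [f] by the sign, [t] to [- f (- t)], gives an isotone function again; it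
         transports the action of [f] from [J] to [I]. *)
      have -> : - cfcR f x = cfcR (fun t => - f (- t)) (- x).
        have negE g (z : A) : star z = z -> continuous g ->
            - cfcR g z = cfcR (fun t => - g t) z.
          move=> sz cg'; have -> : (fun t => - g t) = fun t => -1 * g t.
            by apply/funext => t; rewrite mulN1r.
          by rewrite (cfcRZ sz) // rmorphN rmorph1 scaleN1r.
        have -> : - x = cfcR (fun t => - t) x.
          by rewrite -[in LHS](cfcR_id sx) negE //; exact: continuous_idR.
        rewrite cfcR_comp // negE //.
        by congr cfcR; apply/funext => t; rewrite opprK.
      by apply: iso => //; split=> // s t st; rewrite lerN2 hf // lerN2.
    + by rewrite !mulrNN.
  by [].
Qed.

Lemma weak_ultraweak I : weak_isocone I -> ultraweak_isocone I.
Proof.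
move=> [Isa Icst Iadd Iscale Ilat Icl Idense]; split=> // f [cf hf] _ [b Ib <-].
have sb : star b = b := Isa b Ib.
(* Any two elements [g(b)] and [g'(b)] commute, so the lattice axiom applies to them, and their join
   and meet are the pointwise maximum and minimum evaluated at [b]. Hence [K] has the closure
   properties needed for approximating [f]. *)
pose K : set (R -> R) := [set g | continuous g /\ I (cfcR g b)].
have lat g g' : K g -> K g' ->
    K (fun t => Num.max (g t) (g' t)) /\ K (fun t => Num.min (g t) (g' t)).
  move=> [cg Ig] [cg' Ig'].
  have cB := continuous_fun_sub cg cg'; have cn := continuous_fun_norm cB.
  have cD := continuous_fun_add cg cg'.
  have comm : cfcR g b * cfcR g' b = cfcR g' b * cfcR g b.
    by rewrite -!(cfcRM sb) //; congr cfcR; apply/funext => t; rewrite mulrC.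
  have nE : cabs (cfcR g b - cfcR g' b) = cfcR (fun t => `|g t - g' t|) b.
    by rewrite -(cfcRB sb) // /cabs cfcR_comp //; exact: norm_continuous.
  have [Imax Imin] := Ilat _ _ Ig Ig' comm.
  have maxE : (fun t => Num.max (g t) (g' t)) = fun t => 2^-1 * (g t + g' t + `|g t - g' t|).
    by apply/funext => t; exact: maxr_norm.
  have minE : (fun t => Num.min (g t) (g' t)) = fun t => 2^-1 * (g t + g' t - `|g t - g' t|).
    by apply/funext => t; case: (leP (g t) (g' t)) => ?; [rewrite ler0_norm|rewrite gtr0_norm]; lra.
  split; split.
  - exact: continuous_fun_max.
  - rewrite maxE (cfcRZ sb); last exact: continuous_fun_add.
    by rewrite (cfcRD sb) // (cfcRD sb) // -nE -two_inv.
  - by rewrite minE; apply/continuous_fun_scale/continuous_fun_sub.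
  - rewrite minE (cfcRZ sb); last exact: continuous_fun_sub.
    by rewrite (cfcRB sb) // (cfcRD sb) // -nE -two_inv.
apply: closed_nrm => // e e0.
have Kf : approximable K (nrm b) f.
  apply: isotone_approximation => //; first exact: nrm_ge0.
  - by move=> c; split; [exact: continuous_cstR|rewrite (cfcR_cst sb)].
  - by split; [exact: continuous_idR|rewrite cfcR_id].
  - move=> g g' [cg Ig] [cg' Ig']; split; first exact: continuous_fun_add.
    by rewrite (cfcRD sb) //; exact: Iadd.
  - move=> c g c0 [cg Ig]; split; first exact: continuous_fun_scale.
    by rewrite (cfcRZ sb) //; exact: Iscale.
  - by move=> g g' Kg Kg'; have [] := lat g g' Kg Kg'.
  - by move=> g g' Kg Kg'; have [] := lat g g' Kg Kg'.
have [g [cg Ig] fg] := Kf e e0.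
exists (cfcR g b) => //; apply: (cfcR_near sb) => // t bt.
by apply: fg; exact: real_spectrum_bound.
Qed.

End Joins.

Theorem theorem4 (R : realType) (A : cstarAlgType R) (I : set A)
    (hI : I `<=` selfadjoint) :
  ultraweak_isocone I <-> weak_isocone I.
Proof. by split; [exact: ultraweak_weak|exact: weak_ultraweak]. Qed.
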